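(* Let $X$ be a Cantor space, let $K \subseteq \mathrm{Prob}(X)$ be a dynamical simplex, and let $G$ be the group of all homeomorphisms $g$ of $X$ such that $g_*\mu=\mu$ for all $\mu\in K$. Then there exists a $K$-saturated element in $G$.
   Context: $\mathrm{Prob}(X)$ is the compact space of all Borel probability measures on $X$ with the weak-$*$ topology, and $g_*\mu(A)=\mu(g^{-1}(A))$. A nonempty set $K \subseteq \mathrm{Prob}(X)$ is a dynamical simplex if: (1) $K$ is compact and convex; (2) every element of $K$ is atomless and has full support; (3) $K$ is good: for any two clopen sets $A,B \subseteq X$ such that $\mu(A)<\mu(B)$ for all $\mu\in K$, there exists a clopen subset $C \subseteq B$ such that $\mu(C)=\mu(A)$ for all $\mu \in K$; (4) $K$ is approximately divisible: for any clopen set $A\subseteq X$, any integer $n \geq 1$ and any $\varepsilon>0$, there exists a clopen $B \subseteq A$ such that $n\mu(B) \in [\mu(A)-\varepsilon,\mu(A)]$ for all $\mu \in K$. For clopen sets $U,V$, write $U\sim_K V$ if $\mu(U)=\mu(V)$ for all $\mu\in K$. The topological full group $[[g]]$ of a homeomorphism $g$ of $X$ is the group of all homeomorphisms $h$ of $X$ for which there exist a clopen partition $A_1,\ldots,A_n$ of $X$ and integers $n_1,\ldots,n_n$ such that $h(x)=g^{n_i}(x)$ for all $x\in A_i$ and all $i$. An element $g\in G$ is $K$-saturated if for any clopen sets $U,V$ with $U\sim_K V$ there exists $h\in[[g]]$ with $h(U)=V$. *)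

(* Defs.v *)
From HB Require Import structures.
From mathcomp Require Import all_boot all_order all_algebra.
From mathcomp Require Import all_classical all_reals all_analysis.
Set Implicit Arguments.
Unset Strict Implicit.
Unset Printing Implicit Defensive.
Import Order.TTheory GRing.Theory Num.Theory.
Import numFieldNormedType.Exports.

Local Open Scope classical_set_scope.
Local Open Scope ring_scope.

Record homeo (X Y : topologicalType) := Homeo {
  homeo_fun :> X -> Y;
  homeo_inv : Y -> X;
  homeo_funK : cancel homeo_fun homeo_inv;
  homeo_invK : cancel homeo_inv homeo_fun;
  homeo_fun_continuous : continuous homeo_fun;
  homeo_inv_continuous : continuous homeo_inv }.

(* The library predicate [cantor_like] does not include metrizability (the
   uncountable power of bool satisfies it), hence this definition. *)
Definition is_cantor_space (X : topologicalType) : Prop :=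
  $| homeo X cantor_space |.

Definition homeo_pow (X : topologicalType) (g : homeo X X) (n : int) : X -> X :=
  match n with
  | Posz m => iter m g
  | Negz m => iter m.+1 (homeo_inv g)
  end.

Notation borel X := (g_sigma_algebraType (@open X)).
Notation borel_probability R X := (probability (borel X) R).

Section DynamicalSimplices.
Context {R : realType} {X : ptopologicalType}.
Implicit Types (K : set (borel_probability R X)) (A B C U V : set X).

(* [Rintegral] truncates an infinite integral to 0; this never happens on a
   compact [X], where every continuous function is bounded. *)
Definition weak_star_eval (mu : borel_probability R X) :
    {ptws continuousType X R -> R} :=
  fun f : continuousType X R => \int[mu]_x f x.

Definition weak_star : topologicalType := initial_topology weak_star_eval.

(* A [probability] is a function on all subsets of [X] whose values outside
   the Borel sets are unconstrained. Two of them are the same measure when they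
   agree on Borel sets; only those values are compared here and below. *)
Definition convex_measures K : Prop :=
  forall mu nu, K mu -> K nu -> forall t : R, 0 <= t <= 1 ->
  exists2 la, K la & forall A : set (borel X), measurable A ->
    la A = (t%:E * mu A + (1 - t)%:E * nu A)%E.

Definition atomless (mu : borel_probability R X) : Prop :=
  forall x : X, mu [set x] = 0%E.

Definition full_support (mu : borel_probability R X) : Prop :=
  forall U, open U -> U !=set0 -> (0 < mu U)%E.

Definition good K : Prop :=
  forall A B, clopen A -> clopen B ->
  (forall mu, K mu -> (mu A < mu B)%E) ->
  exists C, [/\ clopen C, C `<=` B & forall mu, K mu -> mu C = mu A].

Definition approximately_divisible K : Prop :=
  forall A, clopen A -> forall (n : nat) (e : R), (1 <= n)%N -> 0 < e ->
  exists B, [/\ clopen B, B `<=` A &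
    forall mu, K mu -> (mu A - e%:E <= n%:R%:E * mu B <= mu A)%E].

Record dynamical_simplex K : Prop := DynamicalSimplex {
  dynamical_simplex_nonempty : K !=set0;
  dynamical_simplex_compact : compact (K : set weak_star);
  dynamical_simplex_convex : convex_measures K;
  dynamical_simplex_atomless : forall mu, K mu -> atomless mu;
  dynamical_simplex_full_support : forall mu, K mu -> full_support mu;
  dynamical_simplex_good : good K;
  dynamical_simplex_divisible : approximately_divisible K }.

Definition equimeasured K U V : Prop := forall mu, K mu -> mu U = mu V.

Definition invariance_group K : set (homeo X X) :=
  [set g | forall mu, K mu -> forall A : set (borel X), measurable A ->
    pushforward mu (g : borel X -> borel X) A = mu A].

Definition topological_full_group (g : homeo X X) : set (homeo X X) :=
  [set h | exists (n : nat) (A : 'I_n -> set X) (k : 'I_n -> int),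
    [/\ partition [set: 'I_n] A [set: X],
        forall i, clopen (A i) &
        forall i x, A i x -> h x = homeo_pow g (k i) x]].

Definition saturated K (g : homeo X X) : Prop :=
  forall U V, clopen U -> clopen V -> equimeasured K U V ->
  exists2 h, topological_full_group g h & h @` U = V.

End DynamicalSimplices.

(* Main.v *)
(** A tower partition cuts [X] into finitely many columns, each a finite list
    of nonempty clopen sets on which every measure of [K] takes the same value.
    Along a sequence of successively finer tower partitions, moving each point
    one level up and the top levels to the bottom levels defines a
    homeomorphism [g] as soon as the levels generate the topology and the bottom
    and top levels each shrink to a point; [g] then preserves [K].

    If [U] and [V] are equimeasured unions of levels, give a column the
    coefficient #(levels in [U]) - #(levels in [V]).  The coefficients weighted
    by the base measures sum to zero.  Goodness makes it possible to cut a column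
    [v] of largest coefficient [M > 0] into pieces stacked on pieces of the columns
    of negative coefficient, because [M v <= sum (- k_w) w <= M sum w] over those
    columns; each new column has coefficient in [0, M).  By descent all
    coefficients become 0 (this is Shen's argument for dimension groups), and then
    permuting levels inside each column maps [U] to [V] by an element of the
    full group.  Stacking small pieces in the same way shrinks the bottom and
    top levels. *)

Require Import Defs.
From HB Require Import structures.
From mathcomp Require Import all_boot all_order all_algebra.
From mathcomp Require Import all_classical all_reals all_analysis.
From mathcomp Require Import zify ring.
Set Implicit Arguments.
Unset Strict Implicit.
Unset Printing Implicit Defensive.
Import Order.TTheory GRing.Theory Num.Theory.
Import numFieldNormedType.Exports.

Local Open Scope classical_set_scope.
Local Open Scope ring_scope.

(** * Limits of relations and powers of homeomorphisms *)

Section Limit.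
Context {X : topologicalType} (cX : compact [set: X])
  (hX : hausdorff_space X) (zX : zero_dimensional X).

(** Compactness gives every [x] some [y] related to it at all stages. Deciding clopen sets makes
    this [y] unique, since clopen sets separate points, and continuous in [x], since at any one
    stage nearby points have the same successors. *)
Lemma limit_map (r : nat -> X -> X -> Prop) :
  (forall n x y, r n.+1 x y -> r n x y) ->
  (forall n x, exists y, r n x y) ->
  (forall n x, \forall x' \near x, forall y, r n x y <-> r n x' y) ->
  (forall n y, \forall y' \near y, forall x, r n x y <-> r n x y') ->
  (forall A, clopen A -> exists n, forall x,
    (forall y, r n x y -> A y) \/ (forall y, r n x y -> ~ A y)) ->
  exists g : X -> X, continuous g /\ forall x y, (forall n, r n x y) <-> y = g x.
Proof.
move=> rS tot nearl nearr dec.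
have mono n k x y : r (n + k)%N x y -> r n x y.
  by elim: k => [|k IH]; rewrite ?addn0// addnS => /rS.
have ex x : exists y, forall n, r n x y.
  apply: contrapT => /forallNP none.
  (* If every [y] fails at some stage, it fails at all later ones and, by local constancy, so do its
     neighbours. Compactness yields a stage [N] at which [x] has no successor, against totality. *)
  have /compact_near_coveringP := cX.
  move=> /(_ nat \oo (fun n y => ~ r n x y) _)[y _|N _ HN].
    have /existsNP[n nr] := none y.
    exists ([set y' | forall x, r n x y <-> r n x y'], [set k | (n <= k)%N]).
      by split; [exact: nearr|exists n].
    move=> [y' k] /= [yy' nk] rk; apply/nr/yy'.
    by apply: (mono n (k - n)%N); rewrite subnKC.
  have [y ry] := tot N x.
  by have := HN N (leqnn N) y I; apply.
have uniq x y y' : (forall n, r n x y) -> (forall n, r n x y') -> y = y'.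
  move=> ry ry'; apply: contrapT => /eqP /zX[A [cA Ay nAy']].
  by have [n /(_ x)[h|h]] := dec A cA; [apply: nAy'; exact: h|exact: h Ay].
have [g gP] := choice ex.
exists g; split=> [x|x y]; last first.
  by split=> [h|->//]; apply: uniq h (gP x).
move=> N /(zero_dimensional_cvg hX zX cX)[A [Agx cA] AN].
have [n /(_ x) dA] := dec A cA.
apply: filterS (nearl n x) => x' xx'; apply: AN => /=.
have rx : r n x (g x') by apply/xx'; exact: gP.
by case: dA => [|nA]; [exact|case: (nA _ (gP x n) Agx)].
Qed.

(** The hypotheses are symmetric in the two variables, so the converse relations also have a
    continuous limit, and uniqueness makes the two limits inverse to each other. *)
Lemma limit_homeo (r : nat -> X -> X -> Prop) :
  (forall n x y, r n.+1 x y -> r n x y) ->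
  (forall n x, exists y, r n x y) -> (forall n y, exists x, r n x y) ->
  (forall n x, \forall x' \near x, forall y, r n x y <-> r n x' y) ->
  (forall n y, \forall y' \near y, forall x, r n x y <-> r n x y') ->
  (forall A, clopen A -> exists n, forall x,
    (forall y, r n x y -> A y) \/ (forall y, r n x y -> ~ A y)) ->
  (forall A, clopen A -> exists n, forall y,
    (forall x, r n x y -> A x) \/ (forall x, r n x y -> ~ A x)) ->
  exists g : homeo X X, forall n x, r n x (g x).
Proof.
move=> rS tot tot' nl nr dec dec'.
have [g [cg gP]] := limit_map rS tot nl nr dec.
have [h [ch hP]] := @limit_map (fun n x y => r n y x) (fun n x y => rS n y x)
  tot' nr nl dec'.
have gh : cancel g h by move=> x; apply/esym/hP/gP.
have hg : cancel h g by move=> x; apply/esym/gP/hP.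
by exists (Homeo gh hg cg ch) => n x /=; apply: (gP x (g x)).2.
Qed.

End Limit.

Lemma homeo_powK (X : topologicalType) (g : homeo X X) k x :
  homeo_pow g (- k) (homeo_pow g k x) = x.
Proof.
have iterK (f h : X -> X) n : cancel f h -> cancel (iter n f) (iter n h).
  by move=> fh; elim: n => // n IH y; rewrite iterSr iterS fh IH.
case: k => [[|n]|n] //.
  by rewrite -NegzE /=; apply: (iterK g (homeo_inv g) n.+1 (@homeo_funK _ _ g)).
rewrite NegzE opprK -NegzE.
exact: (iterK (homeo_inv g) g n.+1 (@homeo_invK _ _ g)).
Qed.

Lemma homeo_pow_continuous (X : topologicalType) (g : homeo X X) k :
  continuous (homeo_pow g k).
Proof.
have iterC (f : X -> X) n : continuous f -> continuous (iter n f).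
  move=> cf; elim: n => [|n IH] x; first exact: cvg_id.
  exact: (continuous_comp (IH x) (cf _)).
by case: k => n; apply: iterC; [exact: homeo_fun_continuous|
  exact: homeo_inv_continuous].
Qed.

(** As many positions satisfy only [u] as only [v]. The involution matches these two lists in order
    and fixes all other positions. *)
Lemma swap_involution (T : Type) (x0 : T) (u v : pred T) (s : seq T) :
  count u s = count v s ->
  exists f : nat -> nat, forall j, (j < size s)%N ->
    [/\ (f j < size s)%N, f (f j) = j, u (nth x0 s (f j)) = v (nth x0 s j) &
        v (nth x0 s (f j)) = u (nth x0 s j)].
Proof.
move=> uv.
pose U j := u (nth x0 s j); pose V j := v (nth x0 s j).
have cE (p : pred T) : count p s = count (fun j => p (nth x0 s j)) (iota 0 (size s)).
  by rewrite -[s in LHS](mkseq_nth x0) /mkseq count_map.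
pose A := [seq j <- iota 0 (size s) | U j && ~~ V j].
pose B := [seq j <- iota 0 (size s) | V j && ~~ U j].
have sAB : size A = size B.
  move: uv; rewrite !cE -/U -/V => uv.
  have := count_predC V [seq j <- iota 0 (size s) | U j].
  have := count_predC U [seq j <- iota 0 (size s) | V j].
  rewrite !count_filter !size_filter uv => <-.
  rewrite (eq_count (_ : predI V U =1 predI U V)); last first.
    by move=> j /=; rewrite andbC.
  move=> /addnI h; rewrite -(eq_count (_ : predI (predC V) U =1 _)); last first.
    by move=> j /=; rewrite andbC.
  by rewrite h; apply: eq_count => j /=; rewrite andbC.
have uA : uniq A by rewrite filter_uniq ?iota_uniq.
have uB : uniq B by rewrite filter_uniq ?iota_uniq.
have memA j : (j \in A) = [&& (j < size s)%N, U j & ~~ V j].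
  by rewrite mem_filter mem_iota /= add0n andbC.
have memB j : (j \in B) = [&& (j < size s)%N, V j & ~~ U j].
  by rewrite mem_filter mem_iota /= add0n andbC.
pose f j := if j \in A then nth 0%N B (index j A) else
  if j \in B then nth 0%N A (index j B) else j.
exists f => j js; rewrite -!/(U _) -!/(V _) /f.
case: ifPn => jA.
  have iB : (index j A < size B)%N by rewrite -sAB index_mem.
  have := mem_nth 0%N iB; set i := nth _ _ _ => iBm.
  have iA : (i \in A) = false.
    by move: iBm; rewrite memA memB; case: (V i); rewrite ?andbF.
  rewrite iA iBm /i index_uniq// nth_index//; split=> //; move: jA iBm;
    rewrite memA memB -/i => /and3P[_ uj vj] /and3P[? vi ui] //;
    by rewrite ?uj ?vi// (negPf ui) (negPf vj).
case: ifPn => jB.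
  have iA : (index j B < size A)%N by rewrite sAB index_mem.
  have := mem_nth 0%N iA; set i := nth _ _ _ => iAm.
  rewrite iAm /i index_uniq// nth_index//; split=> //; move: jB iAm;
    rewrite memA memB -/i => /and3P[_ vj uj] /and3P[? ui vi] //;
    by rewrite ?ui ?vj// (negPf uj) (negPf vi).
rewrite (negPf jA) (negPf jB); split=> //; move: jA jB; rewrite memA memB js /=;
  by case: (U j); case: (V j).
Qed.

(** * Columns and tower partitions *)

(** The form in which a dynamical simplex enters the construction: [I] indexes its measures, and
    only clopen sets are measured. The last clause partitions [A] into pieces smaller than [S] for
    every measure at once; it will come from compactness and the absence of atoms. *)
Record good_family (R : realType) (X : topologicalType) (I : Type)
    (m : I -> set X -> R) : Prop := GoodFamily {
  good_family_inh : inhabited I;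
  good_family_add : forall i A B, clopen A -> clopen B -> A `&` B = set0 ->
    m i (A `|` B) = m i A + m i B;
  good_family_pos : forall i A, clopen A -> A !=set0 -> 0 < m i A;
  good_family_good : forall A B, clopen A -> clopen B ->
    (forall i, m i A < m i B) ->
    exists C, [/\ clopen C, C `<=` B & forall i, m i C = m i A];
  good_family_small : forall A S, clopen A -> clopen S -> S !=set0 ->
    exists bs : seq (set X), [/\ forall b, b \in bs -> clopen b,
      forall b, b \in bs -> forall i, m i b < m i S &
      forall x, count (fun b => `[< b x >]) bs = `[< A x >]] }.

Lemma clopenD (X : topologicalType) (A B : set X) :
  clopen A -> clopen B -> clopen (A `\` B).
Proof. by move=> cA cB; rewrite setDE; apply: clopenI => //; apply: clopenC. Qed.

Section Towers.
Context {X : topologicalType}.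
Implicit Types (a c A B C U V : set X) (s t w v : seq (set X))
  (P Q J : seq (seq (set X))).

Definition cnt (x : X) s : nat := count (fun a => `[< a x >]) s.

Definition slice s t :=
  size s = size t /\ forall j, nth set0 s j `<=` nth set0 t j.

(** Cutting and stacking: read from bottom to top, a column of a finer tower is a concatenation of
    thinner copies of columns of [P]. *)
Inductive blocks P : seq (set X) -> Prop :=
| blocks_slice s t : t \in P -> slice s t -> blocks P s
| blocks_cat s t : blocks P s -> blocks P t -> blocks P (s ++ t).

Definition refines Q P := forall w, w \in Q -> blocks P w.

Definition decides A a := a `<=` A \/ a `<=` ~` A.

Lemma cnt_cat x s t : cnt x (s ++ t) = (cnt x s + cnt x t)%N.
Proof. exact: count_cat. Qed.

Lemma asbool_split A B x : B `<=` A ->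
  (`[< A x >] : nat) = (`[< B x >] + `[< (A `\` B) x >])%N.
Proof.
move=> BA; case: (asboolP (A x)) => Ax; case: (asboolP (B x)) => Bx;
  case: (asboolP ((A `\` B) x)) => // -[]//.
by case: Ax; exact: BA.
Qed.

Lemma slice_refl s : slice s s.
Proof. by split=> // j. Qed.

Lemma slice_trans t s w : slice s t -> slice t w -> slice s w.
Proof.
by move=> [h1 h2] [h3 h4]; split=> [|j]; [rewrite h1|apply: subset_trans (h4 j)].
Qed.

Lemma slice_cons a b s t : a `<=` b -> slice s t -> slice (a :: s) (b :: t).
Proof. by move=> ab [h1 h2]; split=> [|[]//]; rewrite /= h1. Qed.

Lemma slice_cat s1 s2 t1 t2 :
  slice s1 t1 -> slice s2 t2 -> slice (s1 ++ s2) (t1 ++ t2).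
Proof.
move=> [h1 h2] [h3 h4]; split=> [|j]; first by rewrite !size_cat h1 h3.
by rewrite !nth_cat h1; case: ifP.
Qed.

Lemma slice_catR s t1 t2 : slice s (t1 ++ t2) ->
  exists s1 s2, [/\ s = s1 ++ s2, slice s1 t1 & slice s2 t2].
Proof.
move=> [h1 h2]; exists (take (size t1) s), (drop (size t1) s).
have st : (size t1 <= size s)%N by rewrite h1 size_cat leq_addr.
split; first by rewrite cat_take_drop.
- split=> [|j]; first by rewrite size_takel.
  have := h2 j; rewrite nth_cat; case: ltnP => jt; first by rewrite nth_take.
  by move=> _; rewrite nth_default// size_takel.
- split=> [|j]; first by rewrite size_drop h1 size_cat addKn.
  by have := h2 (size t1 + j)%N; rewrite nth_cat nth_drop ltnNge leq_addr addKn.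
Qed.

Lemma blocks_trans_slice P s t : blocks P t -> slice s t -> blocks P s.
Proof.
move=> Pt; elim: Pt s => [u v vP uv s su|u v _ IHu _ IHv s].
  exact: blocks_slice vP (slice_trans su uv).
by move=> /slice_catR[s1 [s2 [-> su sv]]]; apply: blocks_cat; auto.
Qed.

Lemma blocks_trans P Q s : refines Q P -> blocks Q s -> blocks P s.
Proof.
move=> QP; elim=> [u v vQ uv|u v _ IHu _ IHv].
  exact: blocks_trans_slice (QP _ vQ) uv.
exact: blocks_cat.
Qed.

Lemma refines_refl P : refines P P.
Proof. by move=> w wP; apply: blocks_slice wP (slice_refl _). Qed.

Lemma refines_trans P Q P' : refines P' Q -> refines Q P -> refines P' P.
Proof. by move=> h1 h2 w /h1; apply: blocks_trans. Qed.

Lemma blocks_neq0 P w : (forall v, v \in P -> v != [::]) -> blocks P w ->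
  w != [::].
Proof.
move=> P0; elim=> [s t tP [st _]|[|a s] t _ IH _ _ //].
by have := P0 _ tP; rewrite -!size_eq0 st.
Qed.

Lemma mem_blocks P w a : blocks P w -> a \in w ->
  exists2 b, b \in flatten P & a `<=` b.
Proof.
move=> Pw; elim: Pw a => [s t tP [st h] a aw|s t _ IHs _ IHt a].
  exists (nth set0 t (index a s)); last by rewrite -{1}(nth_index set0 aw).
  by apply/flattenP; exists t => //; rewrite mem_nth// -st index_mem.
by rewrite mem_cat => /orP[/IHs|/IHt].
Qed.

Lemma decides_blocks P A w : (forall a, a \in flatten P -> decides A a) ->
  blocks P w -> forall a, a \in w -> decides A a.
Proof.
move=> dA Pw a /(mem_blocks Pw)[b /dA[bA|bA] ab]; [left|right];
  exact: subset_trans bA.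
Qed.

Lemma head_blocks P w : (forall v, v \in P -> v != [::]) -> blocks P w ->
  exists2 v, v \in P & head set0 w `<=` head set0 v.
Proof.
move=> P0; elim=> [s t tP [st h]|s t Ps [v vP h] Pt _].
  by exists t => //; rewrite -!nth0; exact: h.
by exists v => //; case: s Ps h => [/(blocks_neq0 P0)|].
Qed.

Lemma last_blocks P w : (forall v, v \in P -> v != [::]) -> blocks P w ->
  exists2 v, v \in P & last set0 w `<=` last set0 v.
Proof.
move=> P0; elim=> [s t tP [st h]|s t Ps _ Pt [v vP h]].
  by exists t => //; rewrite -!nth_last st; exact: h.
exists v => //; rewrite last_cat.
by case: t Pt h => [/(blocks_neq0 P0)|].
Qed.

(** * Cutting columns *)

Section Measured.
Context {R : realType} {I : Type} (m : I -> set X -> R).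
Context (mG : good_family m).

Let m_add := good_family_add mG.
Let m_pos := good_family_pos mG.

Definition equiv A B := forall i, m i A = m i B.

Definition class c s := forall a, a \in s -> clopen a /\ equiv a c.

Definition column w :=
  [/\ w != [::], class (head set0 w) w & head set0 w !=set0].

(* The covering number [1] says both that the levels are disjoint and that they
   cover [X]; it is additive under cutting and stacking columns. *)
Definition tower P :=
  (forall w, w \in P -> column w) /\ forall x, cnt x (flatten P) = 1%N.

Lemma m0 i : m i set0 = 0.
Proof.
have := m_add i clopen0 clopen0 (setI0 _); rewrite setU0 => /eqP.
by rewrite addrC -subr_eq subrr eq_sym => /eqP.
Qed.

Lemma m_diff i A B : clopen A -> clopen B -> B `<=` A ->
  m i A = m i B + m i (A `\` B).
Proof.
move=> cA cB BA; rewrite -m_add ?setDIK//; last exact: clopenD.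
by rewrite setDUK.
Qed.

Lemma equiv_null A : clopen A -> equiv A set0 -> A = set0.
Proof.
move=> cA A0; apply: contrapT => /eqP/set0P An0.
case: (good_family_inh mG) => i.
by have := m_pos i cA An0; rewrite A0 m0 ltxx.
Qed.

Lemma equiv_nonempty A B : clopen A -> clopen B -> equiv A B ->
  A !=set0 -> B !=set0.
Proof.
move=> cA cB AB A0; apply/set0P/negP => /eqP B0.
by move/set0P/negP: A0; apply; apply/eqP/equiv_null => //; rewrite -B0.
Qed.

(** Goodness asks for a strict inequality, which positivity supplies unless [b2] is empty; in that
    case [a] itself serves. *)
Lemma split_set a b1 b2 : clopen a -> clopen b1 -> clopen b2 ->
  (forall i, m i a = m i b1 + m i b2) ->
  exists a1, [/\ clopen a1, a1 `<=` a, equiv a1 b1 & equiv (a `\` a1) b2].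
Proof.
move=> ca c1 c2 h.
suff [a1 [ca1 a1a e1]] : exists a1, [/\ clopen a1, a1 `<=` a & equiv a1 b1].
  exists a1; split=> // i.
  by have := h i; rewrite (m_diff i ca ca1 a1a) e1 => /addrI.
have [b20|/set0P b20] := eqVneq b2 set0.
  by exists a; split=> // i; rewrite h b20 m0 addr0.
have [i|C [cC Ca CE]] := good_family_good mG c1 ca.
  by rewrite h ltrDl m_pos.
by exists C.
Qed.

(** Every level is split independently by [split_set]. Only the measures of [b1] and [b2] matter, so
    these sets need not lie in any level, nor in [b]. *)
Lemma cut b b1 b2 s : clopen b1 -> clopen b2 ->
  (forall i, m i b = m i b1 + m i b2) -> class b s ->
  exists s1 s2, [/\ class b1 s1, class b2 s2, slice s1 s, slice s2 s &
    forall x, cnt x s = (cnt x s1 + cnt x s2)%N].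
Proof.
move=> c1 c2 h; elim: s => [|a s IH] bs.
  by exists [::], [::]; split=> //; split=> // j.
have [|s1 [s2 [h1 h2 h3 h4 h5]]] := IH.
  by move=> u us; apply: bs; rewrite inE us orbT.
have [ca ea] : clopen a /\ equiv a b by apply: bs; rewrite inE eqxx.
have [|a1 [ca1 a1a e1 e2]] := split_set ca c1 c2.
  by move=> i; rewrite ea h.
exists (a1 :: s1), ((a `\` a1) :: s2); split.
- by move=> u; rewrite inE => /orP[/eqP->|/h1].
- move=> u; rewrite inE => /orP[/eqP->|/h2//].
  by split=> //; exact: clopenD.
- exact: slice_cons.
- by apply: slice_cons => // x [].
- move=> x; rewrite /cnt /= in h5 *.
  by rewrite h5 (asbool_split x a1a) addnACA.
Qed.

Lemma class_head c w : w != [::] -> class c w ->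
  clopen (head set0 w) /\ equiv (head set0 w) c.
Proof. by case: w => // a w _; apply; rewrite inE eqxx. Qed.

Lemma class_column c w : w != [::] -> clopen c -> class c w -> c !=set0 ->
  column w.
Proof.
move=> w0 cc cw c0; have [ch he] := class_head w0 cw.
split=> //; last exact: equiv_nonempty (fun i => esym (he i)) c0.
by move=> a /cw[ca ac]; split=> // i; rewrite ac he.
Qed.

Lemma column_clopen w : column w -> clopen (head set0 w).
Proof. by case=> w0 cw _; have [] := class_head w0 cw. Qed.

Lemma column_mem w a : column w -> a \in w ->
  [/\ clopen a, equiv a (head set0 w) & a !=set0].
Proof.
move=> cw aw; have ch := column_clopen cw; case: cw => w0 cw h0.
have [ca ea] := cw _ aw; split=> //.
exact: equiv_nonempty (fun i => esym (ea i)) h0.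
Qed.

Lemma column_class c w : column w -> clopen c -> class c w -> c !=set0.
Proof.
move=> [w0 _ h0] cc /(class_head w0)[ch he].
exact: equiv_nonempty he h0.
Qed.

Lemma slice_neq0 s t : slice s t -> t != [::] -> s != [::].
Proof. by move=> [st _]; rewrite -!size_eq0 st. Qed.

(** A cut may leave a piece all of whose levels are empty, which is not a column. Dropping it
    changes neither covering numbers nor sums of base measures. *)
Definition keep w := if `[< head set0 w !=set0 >] then [:: w] else [::].

Lemma keepP c w : w != [::] -> clopen c -> class c w ->
  [/\ forall u, u \in keep w -> u = w /\ column w,
      forall x, cnt x (flatten (keep w)) = cnt x w,
      forall i, \sum_(u <- keep w) m i (head set0 u) = m i c &
      (size (keep w) <= 1)%N].
Proof.
move=> w0 cc cw; have [ch he] := class_head w0 cw.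
rewrite /keep; case: asboolP => h0.
  split=> //.
  - move=> u; rewrite inE => /eqP ->; split=> //.
    exact: class_column w0 cc cw (equiv_nonempty ch cc he h0).
  - by move=> x; rewrite /= cats0.
  - by move=> i; rewrite big_seq1.
have c0 : c = set0.
  apply: contrapT => /eqP/set0P c0; apply: h0.
  exact: equiv_nonempty (fun i => esym (he i)) c0.
split=> //; last by move=> i; rewrite big_nil c0 m0.
move=> x; rewrite /= /cnt -(@eq_in_count _ pred0) ?count_pred0// => a /cw[ca ea].
rewrite asboolF//; suff -> : a = set0 by [].
by apply: equiv_null => // i; rewrite ea c0.
Qed.

Lemma null_class s x : class set0 s -> cnt x s = 0%N.
Proof.
move=> cs; rewrite /cnt -(@eq_in_count _ pred0) ?count_pred0// => a /cs[ca ea].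
by rewrite (equiv_null ca ea) asboolF.
Qed.

Lemma count_set0 s A : (forall x, cnt x s = `[< A x >]) -> s = [::] ->
  A = set0.
Proof.
move=> h s0; rewrite predeqE => x; split=> // Ax.
by have := h x; rewrite s0 asboolT.
Qed.

Lemma count_cons_sub a s A : (forall x, cnt x (a :: s) = `[< A x >]) ->
  a `<=` A /\ forall x, cnt x s = `[< (A `\` a) x >].
Proof.
move=> h.
have aA : a `<=` A.
  by move=> x ax; have := h x; rewrite /cnt /= asboolT//; case: asboolP.
split=> // x; have := h x.
by rewrite /cnt /= (asbool_split x aA) => /addnI.
Qed.

Lemma sum_measure s A : (forall a, a \in s -> clopen a) ->
  (forall x, cnt x s = `[< A x >]) ->
  clopen A /\ forall i, m i A = \sum_(a <- s) m i a.
Proof.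
elim: s A => [|a s IH] A cs h.
  rewrite (count_set0 h erefl); split; first exact: clopen0.
  by move=> i; rewrite m0 big_nil.
have [aA h'] := count_cons_sub h.
have ca : clopen a by apply: cs; rewrite inE eqxx.
have [|cD IHm] := IH _ _ h'; first by move=> u us; apply: cs; rewrite inE us orbT.
have AE : A = a `|` (A `\` a) by rewrite setDUK.
split; first by rewrite AE; exact: clopenU.
move=> i; rewrite AE m_add// ?setDIK// big_cons IHm//.
Qed.

(** The members of [s] are peeled off one at a time, each cutting from the column a slice of its own
    measure. The set [A] is only a reference for measures and need not meet [w]. *)
Lemma subdivide A s w : clopen A -> (forall a, a \in s -> clopen a) ->
  (forall x, cnt x s = `[< A x >]) -> w != [::] -> class A w ->
  exists Q, (forall u, u \in Q ->
      [/\ column u, slice u w & exists2 a, a \in s & equiv (head set0 u) a]) /\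
    forall x, cnt x (flatten Q) = cnt x w.
Proof.
elim: s A w => [|a s IH] A w cA cs h w0 Aw.
  rewrite (count_set0 h erefl) in Aw.
  exists [::]; split=> [u|x]; first by rewrite in_nil.
  by rewrite (null_class x Aw).
have [aA h'] := count_cons_sub h.
have ca : clopen a by apply: cs; rewrite inE eqxx.
have cD : clopen (A `\` a) by apply: clopenD.
have [w1 [w2 [k1 k2 s1 s2 cw]]] := cut ca cD (fun i => m_diff i cA ca aA) Aw.
have n1 := slice_neq0 s1 w0; have n2 := slice_neq0 s2 w0.
have [|Q [QP cQ]] := IH _ w2 cD _ h' n2 k2.
  by move=> u us; apply: cs; rewrite inE us orbT.
have [K1 K2 _ _] := keepP n1 ca k1.
exists (keep w1 ++ Q); split=> [u|x]; last first.
  by rewrite flatten_cat cnt_cat K2 cQ cw.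
rewrite mem_cat => /orP[/K1[-> cu]|/QP[cu u2 [b bs ub]]].
  by split=> //; exists a; [rewrite inE eqxx|have [] := class_head n1 k1].
split=> //; first exact: slice_trans u2 s2.
by exists b => //; rewrite inE bs orbT.
Qed.

Lemma decides_slice A s t : slice s t -> (forall a, a \in t -> decides A a) ->
  forall a, a \in s -> decides A a.
Proof.
move=> st dt a; apply: (@decides_blocks [:: t]).
  by move=> b; rewrite /= cats0; exact: dt.
by apply: blocks_slice st; rewrite inE.
Qed.

(** The levels in [s] are already decided. Cutting the whole column in the proportion in which [A]
    divides the next level settles that level too, and slices inherit the earlier decisions. *)
Lemma split_column A c s t : clopen A -> clopen c -> s ++ t != [::] ->
  class c (s ++ t) -> (forall a, a \in s -> decides A a) ->
  exists Q, (forall u, u \in Q ->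
      [/\ column u, slice u (s ++ t) & forall a, a \in u -> decides A a]) /\
    forall x, cnt x (flatten Q) = cnt x (s ++ t).
Proof.
move=> cA; move: {2}(size t) (erefl (size t)) => n st; move: st c s.
elim: n t => [|n IH] [|a t]// st c s cc n0 k ds.
  have [K1 K2 _ _] := keepP n0 cc k.
  exists (keep (s ++ [::])); split=> // u /K1[-> ?]; split=> //.
    exact: slice_refl.
  by rewrite cats0.
have [ca ea] : clopen a /\ equiv a c.
  by apply: k; rewrite mem_cat inE eqxx orbT.
have ca1 : clopen (a `&` A) by apply: clopenI.
have ca2 : clopen (a `\` (a `&` A)) by apply: clopenD.
have mc i : m i c = m i (a `&` A) + m i (a `\` (a `&` A)).
  by rewrite -ea; apply: m_diff => // x [].
have [|s1 [s2 [ks1 ks2 ss1 ss2 cs]]] := @cut c _ _ s ca1 ca2 mc.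
  by move=> u us; apply: k; rewrite mem_cat us.
have [|t1 [t2 [kt1 kt2 st1 st2 ct]]] := @cut c _ _ t ca1 ca2 mc.
  by move=> u us; apply: k; rewrite mem_cat inE us !orbT.
(* Both halves are handled alike: [a'] is the part of [a] inside or outside [A], and it is moved to
   the decided levels before the induction hypothesis is applied. *)
have step s' t' a' : clopen a' -> class a' s' -> class a' t' -> decides A a' ->
    a' `<=` a -> slice s' s -> slice t' t ->
    exists Q, (forall u, u \in Q -> [/\ column u, slice u (s ++ a :: t) &
      forall a, a \in u -> decides A a]) /\
    forall x, cnt x (flatten Q) = cnt x (s' ++ a' :: t').
  move=> ca' ks kt da a'a ss t't.
  have [||||Q [QP cQ]] := IH t' _ a' (s' ++ [:: a']) ca'.
  - by case: t't st => -> _ [->].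
  - by rewrite -size_eq0 !size_cat/= addn1.
  - move=> u; rewrite !mem_cat inE -orbA.
    by case/or3P=> [/ks//|/eqP->//|/kt//].
  - move=> u; rewrite mem_cat inE => /orP[us|/eqP->//].
    exact: decides_slice ss ds _ us.
  exists Q; split=> [u /QP[h1 h2 h3]|x]; last by rewrite cQ -catA.
  split=> //; apply: slice_trans h2 _; rewrite -catA.
  by apply: slice_cat => //; exact: slice_cons.
have [||Q1 [Q1P cQ1]] := step s1 t1 _ ca1 ks1 kt1 _ _ ss1 st1.
- by left=> x [].
- by move=> x [].
have [||Q2 [Q2P cQ2]] := step s2 t2 _ ca2 ks2 kt2 _ _ ss2 st2.
- by right=> x [ax nA Ax]; apply: nA.
- by move=> x [].
exists (Q1 ++ Q2); split=> [u|x]; first by rewrite mem_cat => /orP[/Q1P|/Q2P].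
rewrite flatten_cat cnt_cat cQ1 cQ2 !cnt_cat cs addnACA; congr addn.
rewrite /cnt /= -!/(cnt _ _) ct (@asbool_split a (a `&` A)) 1?addnACA//.
Qed.

Lemma flatten_choice (p : seq (set X) -> seq (set X) -> Prop) P :
  (forall w, w \in P -> exists Q, (forall u, u \in Q -> p w u) /\
    forall x, cnt x (flatten Q) = cnt x w) ->
  exists Q, (forall u, u \in Q -> exists2 w, w \in P & p w u) /\
    forall x, cnt x (flatten Q) = cnt x (flatten P).
Proof.
elim: P => [|w P IH] h; first by exists [::].
have [|Q [QP cQ]] := IH; first by move=> v vP; apply: h; rewrite inE vP orbT.
have [|Q' [QP' cQ']] := h w; first by rewrite inE eqxx.
exists (Q' ++ Q); split=> [u|x]; last by rewrite flatten_cat !cnt_cat cQ cQ'.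
rewrite mem_cat => /orP[/QP' pu|/QP[v vP pv]].
  by exists w => //; rewrite inE eqxx.
by exists v => //; rewrite inE vP orbT.
Qed.

Lemma tower_decides A P : clopen A -> tower P ->
  exists Q, [/\ tower Q, refines Q P & forall a, a \in flatten Q -> decides A a].
Proof.
move=> cA [colP cP].
have [|Q [QP cQ]] := @flatten_choice (fun w u => [/\ column u, slice u w &
    forall a, a \in u -> decides A a]) P.
  move=> w wP; have cw := colP _ wP; have [w0 kw _] := cw.
  by apply: (@split_column A (head set0 w) [::] w) => //; exact: column_clopen.
exists Q; split.
- by split=> [u /QP[w _ []]//|x]; rewrite cQ.
- by move=> u /QP[w wP [_ uw _]]; exact: blocks_slice uw.
- by move=> a /flattenP[u /QP[w _ [_ _ h]] /h].
Qed.

(** * Stacking columns and shrinking their ends *)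

Definition join (b : bool) s t := if b then s ++ t else t ++ s.

(** This is the end of [s] that survives in [join b s t], so one Boolean treats bottoms and tops
    together. *)
Definition endset (b : bool) s := if b then head set0 s else last set0 s.

Lemma endset_join b s t : s != [::] -> endset b (join b s t) = endset b s.
Proof.
by case: b; [case: s|rewrite /= last_cat; case: s].
Qed.

Lemma endset_slice b s t : slice s t -> endset b s `<=` endset b t.
Proof.
by case: b => -[st h] /=; [rewrite -!nth0|rewrite -!nth_last st]; exact: h.
Qed.

(* The counting clause keeps the number of columns with a given coefficient
   under control: every column of [J] leaves at most one piece unstacked. *)
Lemma stack b J v C : (forall w, w \in J -> column w) -> v != [::] ->
  clopen C -> class C v ->
  (forall x, C x -> has (fun w => `[< head set0 w x >]) J) ->
  exists J1 J2, [/\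
    forall w, w \in J1 -> column w /\ exists2 w0, w0 \in J & slice w w0,
    forall w, w \in J2 -> column w /\ exists w0 w1 v1,
      [/\ w0 \in J, column w1 /\ slice w1 w0, column v1 /\ slice v1 v &
        w = join b w1 v1],
    forall p : pred (seq (set X)),
      (forall s t, t \in J -> slice s t -> column s -> p s -> p t) ->
      (count p J1 <= count p J)%N,
    forall x, cnt x (flatten (J1 ++ J2)) =
      (cnt x (flatten J) + cnt x v)%N &
    forall i, \sum_(w <- J1 ++ J2) m i (head set0 w) =
      \sum_(w <- J) m i (head set0 w)].
Proof.
elim: J v C => [|w J IH] v C colJ v0 cC kv CJ.
  exists [::], [::]; split=> // x; rewrite /= null_class//.
  by suff <- : C = set0 by []; rewrite predeqE => y; split=> // /CJ.
have cw : column w by apply: colJ; rewrite inE eqxx.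
have ch := column_clopen cw; have [w0 kw _] := cw.
set h := head set0 w in ch kw.
(* The part of [C] in the base of [w] prescribes how much of [v] is joined to [w]: both columns are
   cut at this measure. The rest of [v] goes to the remaining columns, with the rest of [C] as
   reference. *)
pose c1 := C `&` h.
have cc1 : clopen c1 by apply: clopenI.
have c1C : c1 `<=` C by move=> x [].
have c1h : c1 `<=` h by move=> x [].
have cC1 : clopen (C `\` c1) by apply: clopenD.
have ch1 : clopen (h `\` c1) by apply: clopenD.
have [v1 [v2 [kv1 kv2 sv1 sv2 cv]]] :=
  cut cc1 cC1 (fun i => m_diff i cC cc1 c1C) kv.
have [w1 [w2 [kw1 kw2 sw1 sw2 cnw]]] :=
  cut cc1 ch1 (fun i => m_diff i ch cc1 c1h) kw.
have nv1 := slice_neq0 sv1 v0; have nv2 := slice_neq0 sv2 v0.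
have nw1 := slice_neq0 sw1 w0; have nw2 := slice_neq0 sw2 w0.
have [||J1 [J2 [J1P J2P JC Jcnt Jsum]]] := IH v2 _ _ nv2 cC1 kv2.
- by move=> u uJ; apply: colJ; rewrite inE uJ orbT.
- move=> x [Cx nc]; have /orP[/asboolP hx|//] := CJ _ Cx.
  by case: nc.
have nj : join b w1 v1 != [::].
  rewrite /join; case: b {IH J2P};
    by case: w1 v1 nw1 nv1 {kw1 sw1 cnw kv1 sv1 cv} => // ? ? [].
have kj : class c1 (join b w1 v1).
  move=> u; rewrite /join; case: b {IH J2P nj}; rewrite mem_cat => /orP[];
    by [exact: kw1|exact: kv1].
have [K1 K2 K3 K4] := keepP nw2 ch1 kw2.
have [L1 L2 L3 L4] := keepP nj cc1 kj.
exists (keep w2 ++ J1), (keep (join b w1 v1) ++ J2); split.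
- move=> u; rewrite mem_cat => /orP[/K1[-> cu]|/J1P[cu [u0 u0J uu]]].
    by split=> //; exists w; rewrite // inE eqxx.
  by split=> //; exists u0; rewrite // inE u0J orbT.
- move=> u; rewrite mem_cat => /orP[/L1[-> cu]|].
    have c10 := column_class cu cc1 kj.
    split=> //; exists w, w1, v1; split=> //; first by rewrite inE eqxx.
      by split=> //; exact: class_column kw1 c10.
    by split=> //; exact: class_column kv1 c10.
  move=> /J2P[cu [u0 [u1 [u2 [u0J uu1 [cu2 uu2] uE]]]]].
  split=> //; exists u0, u1, u2; split=> //; first by rewrite inE u0J orbT.
  by split=> //; exact: slice_trans uu2 sv2.
- move=> p hp; rewrite count_cat /=; apply: leq_add.
    case: (keep w2) K1 K4 => [//|u [|//]] K1 _ /=.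
    have [|-> cu] := K1 u; first by rewrite inE eqxx.
    rewrite addn0; case pw : (p w2) => //.
    by rewrite (hp w2 w)// inE eqxx.
  by apply: JC => s t tJ; apply: hp; rewrite inE tJ orbT.
- move=> x; have := Jcnt x; rewrite !flatten_cat /= !cnt_cat K2 L2.
  have -> : cnt x (join b w1 v1) = (cnt x w1 + cnt x v1)%N.
    by rewrite /join; case: (b); rewrite cnt_cat // addnC.
  by rewrite cv cnw; lia.
- move=> i; have := Jsum i; rewrite !big_cat big_cons /= K3 L3 => <-.
  by rewrite (m_diff i ch cc1 c1h); ring.
Qed.

(** A column contributes at least its base to the covering number, so the bases are disjoint and
    additivity applies. *)
Lemma heads_measure J : (forall w, w \in J -> column w) ->
  (forall x, cnt x (flatten J) <= 1)%N ->
  let B := [set x | has (fun w => `[< head set0 w x >]) J] in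
  clopen B /\ forall i, m i B = \sum_(w <- J) m i (head set0 w).
Proof.
move=> cJ J1 B.
have [|x|cB mB] := @sum_measure (map (head set0) J) B.
- by move=> a /mapP[w /cJ cw ->]; exact: column_clopen.
- have le1 : (count (fun w => `[< head set0 w x >]) J <= 1)%N.
    apply: leq_trans (J1 x).
    elim: J cJ {J1 B} => //= w J IH cJ.
    rewrite cnt_cat leq_add//; last first.
      by apply: IH => u uJ; apply: cJ; rewrite inE uJ orbT.
    have [|w0 _ _] := cJ w; first by rewrite inE eqxx.
    by case: w w0 {cJ} => // a w _; rewrite /cnt /= leq_addr.
  rewrite /cnt count_map.
  have -> : `[< B x >] = has (fun w => `[< head set0 w x >]) J.
    by rewrite /B /= asboolb.
  rewrite has_count.
  have -> : count (preim (head set0) (fun a => `[< a x >])) J =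
      count (fun w => `[< head set0 w x >]) J by apply: eq_count.
  by case: (count _ J) le1 => [|[]].
by split=> // i; rewrite mB big_map.
Qed.

(** Stacking leaves the total base measure of [J] unchanged. The strict inequalities therefore
    persist, and goodness finds room for each column of [vs] in turn. *)
Lemma collapse_loop b J vs : (forall w, w \in J ++ vs -> column w) ->
  (forall x, cnt x (flatten (J ++ vs)) <= 1)%N ->
  (forall v, v \in vs -> forall i,
    m i (head set0 v) < \sum_(w <- J) m i (head set0 w)) ->
  exists Q, (forall w, w \in Q -> [/\ column w, blocks (J ++ vs) w &
      exists2 w0, w0 \in J & endset b w `<=` endset b w0]) /\
    forall x, cnt x (flatten Q) = cnt x (flatten (J ++ vs)).
Proof.
elim: vs J => [|v vs IH] J colJ cJ lt.
  exists J; rewrite cats0 in colJ *; split=> // w wJ; split; first exact: colJ.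
    exact: refines_refl.
  by exists w.
have cv : column v by apply: colJ; rewrite mem_cat inE eqxx orbT.
have colJ' w : w \in J -> column w by move=> wJ; apply: colJ; rewrite mem_cat wJ.
have cJ' x : (cnt x (flatten J) <= 1)%N.
  by apply: leq_trans (cJ x); rewrite flatten_cat cnt_cat leq_addr.
have [cB mB] := heads_measure colJ' cJ'.
have [i|C [cC CB CE]] := good_family_good mG (column_clopen cv) cB.
  by rewrite mB; apply: lt; rewrite inE eqxx.
have [v0 kv _] := cv.
have kC : class C v by move=> a /kv[ca ea]; split=> // i; rewrite ea CE.
have [J1 [J2 [J1P J2P _ Jcnt Jsum]]] := stack b colJ' v0 cC kC CB.
have cE x : cnt x (flatten ((J1 ++ J2) ++ vs)) = cnt x (flatten (J ++ v :: vs)).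
  by rewrite flatten_cat cnt_cat Jcnt [in RHS]flatten_cat /= !cnt_cat addnA.
have [|||Q [QP cQ]] := IH (J1 ++ J2).
- move=> u; rewrite !mem_cat -orbA => /or3P[/J1P[]//|/J2P[]//|uvs].
  by apply: colJ; rewrite mem_cat inE uvs !orbT.
- by move=> x; rewrite cE.
- by move=> u uvs i; rewrite Jsum; apply: lt; rewrite inE uvs orbT.
have memJ w0 : w0 \in J -> w0 \in J ++ v :: vs by rewrite mem_cat => ->.
have ref : refines ((J1 ++ J2) ++ vs) (J ++ v :: vs).
  move=> u; rewrite !mem_cat -orbA => /or3P[||uvs].
  - by move=> /J1P[_ [w0 w0J s]]; exact: blocks_slice (memJ _ w0J) s.
  - move=> /J2P[_ [w0 [w1 [v1 [w0J [_ s1] [_ s2] ->]]]]].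
    have b1 := blocks_slice (memJ _ w0J) s1.
    have b2 : blocks (J ++ v :: vs) v1.
      by apply: blocks_slice s2; rewrite mem_cat inE eqxx orbT.
    by rewrite /join; case: (b); exact: blocks_cat.
  - by apply: refines_refl; rewrite mem_cat inE uvs !orbT.
exists Q; split=> [u /QP[cu ub [w0 w0J uw0]]|x]; last by rewrite cQ cE.
split=> //; first exact: blocks_trans ref ub.
move: w0J; rewrite mem_cat => /orP[/J1P[_ [w1 w1J s]]|].
  by exists w1 => //; apply: subset_trans (@endset_slice b _ _ s).
move=> /J2P[_ [w1 [w2 [v1 [w1J [[n2 _ _] s2] _ w0E]]]]].
exists w1 => //; apply: subset_trans (@endset_slice b _ _ s2).
by rewrite -(endset_join b v1 n2) -w0E.
Qed.

(** All columns other than [S] are first cut so thin that each is narrower than [S], then joined to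
    pieces of [S] at the opposite end. *)
Lemma tower_collapse b (S : seq (set X)) P : tower (S :: P) ->
  exists Q, [/\ tower Q, refines Q (S :: P) &
    forall w, w \in Q -> endset b w `<=` endset b S].
Proof.
move=> [colP cP].
have cS : column S by apply: colP; rewrite inE eqxx.
have [S0 _ hS0] := cS.
have [|vs [vsP cvs]] := @flatten_choice (fun w u => [/\ column u, slice u w &
    forall i, m i (head set0 u) < m i (head set0 S)]) P.
  move=> w wP; have cw : column w by apply: colP; rewrite inE wP orbT.
  have [bs [cbs ltbs bsE]] :=
    good_family_small mG (column_clopen cw) (column_clopen cS) hS0.
  have [w0 kw _] := cw.
  have [Q [QP cQ]] := subdivide (column_clopen cw) cbs bsE w0 kw.
  exists Q; split=> // u /QP[h1 h2 [a abs ea]]; split=> // i.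
  by rewrite ea; exact: ltbs.
have cE x : cnt x (flatten ([:: S] ++ vs)) = cnt x (flatten (S :: P)).
  by rewrite /= !cnt_cat cvs.
have [|||Q [QP cQ]] := @collapse_loop b [:: S] vs.
- move=> w; rewrite inE => /orP[/eqP->//|/vsP[v _ []]//].
- by move=> x; rewrite cE cP.
- by move=> v /vsP[w _ [_ _ h]] i; rewrite big_seq1.
exists Q; split.
- by split=> [w /QP[]//|x]; rewrite cQ cE cP.
- move=> w /QP[_ h _]; apply: blocks_trans h => u.
  rewrite inE => /orP[/eqP->|/vsP[v vP [_ uv _]]].
    by apply: refines_refl; rewrite inE eqxx.
  by apply: blocks_slice uv; rewrite inE vP orbT.
- by move=> w /QP[_ _ [w0]]; rewrite inE => /eqP ->.
Qed.

(** * Balancing the columns *)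

Definition num U s : nat := count (fun a => `[< a `<=` U >]) s.

Definition excess U V s : int := (num U s)%:Z - (num V s)%:Z.

Lemma measure_num P U : tower P -> clopen U ->
  (forall a, a \in flatten P -> decides U a) ->
  forall i, m i U = \sum_(w <- P) (num U w)%:R * m i (head set0 w).
Proof.
move=> [colP cP] cU dU i.
pose s := [seq a <- flatten P | `[< a `<=` U >]].
have [|x|_ ->] := @sum_measure s U.
- move=> a; rewrite mem_filter => /andP[_ /flattenP[w /colP cw]].
  by move=> /(column_mem cw)[].
- rewrite /cnt count_filter; case: asboolP => Ux.
    transitivity (cnt x (flatten P)); last exact: cP.
    apply: eq_in_count => a /dU da /=.
    case: asboolP => //= ax; case: da => h; first by rewrite asboolT.
    by case: (h _ ax).
  rewrite -(@eq_in_count _ pred0) ?count_pred0// => a _ /=.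
  by case: asboolP => //= ax; rewrite asboolF// => /(_ _ ax).
rewrite big_filter big_flatten /=; apply: eq_big_seq => w /colP[w0 kw _].
rewrite -big_filter (@eq_big_seq _ _ _ _ _ _ (fun=> m i (head set0 w))).
  by rewrite big_const_seq count_predT size_filter iter_addr_0 mulr_natl.
by move=> a; rewrite mem_filter => /andP[_ /kw[_ ->]].
Qed.

Lemma sum_excess P U V : tower P -> clopen U -> clopen V ->
  (forall a, a \in flatten P -> decides U a) ->
  (forall a, a \in flatten P -> decides V a) ->
  forall i, \sum_(w <- P) (excess U V w)%:~R * m i (head set0 w) =
    m i U - m i V.
Proof.
move=> tP cU cV dU dV i; rewrite !(measure_num tP)// -sumrB.
by apply: eq_bigr => w _; rewrite /excess intrB mulrBl.
Qed.

(** A nonempty part of a decided level lies on the same side of [U] as that level; an empty one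
    would always be counted. *)
Lemma num_slice U s t : slice s t -> (forall a, a \in s -> a !=set0) ->
  (forall a, a \in t -> decides U a) -> num U s = num U t.
Proof.
elim: s t => [|a s IH] [|b t] [// st h] n0 d.
have ab : a `<=` b := h 0%N.
rewrite /num /=; congr addn; last first.
  apply: IH => [|u us|u ut]; first by split; [case: st|move=> j; exact: (h j.+1)].
    by apply: n0; rewrite inE us orbT.
  by apply: d; rewrite inE ut orbT.
case: (d b) => [|bU|bU]; first by rewrite inE eqxx.
  by rewrite !asboolT//; exact: subset_trans bU.
have [x ax] : a !=set0 by apply: n0; rewrite inE eqxx.
have bx := ab _ ax.
by rewrite !asboolF// => /(_ x); [move=> /(_ bx)|move=> /(_ ax)]; exact: bU.
Qed.

Lemma excess_slice U V s t : slice s t -> column s ->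
  (forall a, a \in t -> decides U a) -> (forall a, a \in t -> decides V a) ->
  excess U V s = excess U V t.
Proof.
move=> st cs dU dV; rewrite /excess !(num_slice st)// => a /(column_mem cs)[] //.
Qed.

Lemma excess_join b U V s t :
  excess U V (join b s t) = excess U V s + excess U V t.
Proof.
have numD W : num W (join b s t) = (num W s + num W t)%N.
  by case: b; rewrite /join /num count_cat// addnC.
by rewrite /excess !numD !PoszD; ring.
Qed.

Lemma excessC U V s : excess V U s = - excess U V s.
Proof. by rewrite /excess opprB. Qed.

Lemma flatten_perm_cnt P Q x : perm_eq P Q ->
  cnt x (flatten P) = cnt x (flatten Q).
Proof. by move=> PQ; apply/permP/perm_flatten. Qed.

(** Stacking all of [v] on columns of negative excess gives columns of excess in [[0, M)]. The
    unstacked remainders of absolute excess [M] are no more numerous than the columns they come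
    from, so the count drops because [v] is gone. *)
Lemma balance_step U V (M : nat) P v : clopen U -> clopen V -> equiv U V ->
  tower P -> (forall a, a \in flatten P -> decides U a) ->
  (forall a, a \in flatten P -> decides V a) ->
  (forall w, w \in P -> (`|excess U V w| <= M)%N) ->
  (0 < M)%N -> v \in P -> excess U V v = M%:Z ->
  exists Q, [/\ tower Q, refines Q P,
    forall w, w \in Q -> (`|excess U V w| <= M)%N &
    (count (fun w => (`|excess U V w| == M)%N) Q <
     count (fun w => (`|excess U V w| == M)%N) P)%N].
Proof.
move=> cU cV UV tP dU dV leM M0 vP vM; have [colP cP] := tP.
pose k w := excess U V w.
pose P' := rem v P.
have pP : perm_eq P (v :: P') by exact: perm_to_rem.
have memP' w : w \in P' -> w \in P by exact: mem_rem.
pose J := [seq w <- P' | k w < 0]; pose N := [seq w <- P' | ~~ (k w < 0)].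
have permJ : perm_eq P' (J ++ N) by rewrite perm_sym perm_filterC.
have memJ w : w \in J -> w \in P /\ k w < 0.
  by rewrite mem_filter => /andP[? /memP'].
have memN w : w \in N -> w \in P /\ 0 <= k w.
  by rewrite mem_filter -leNgt => /andP[? /memP'].
have cE x : cnt x (flatten P) =
    (cnt x v + (cnt x (flatten J) + cnt x (flatten N)))%N.
  rewrite (flatten_perm_cnt _ pP) /= cnt_cat (flatten_perm_cnt _ permJ).
  by rewrite flatten_cat cnt_cat.
have colJ w : w \in J -> column w by move=> /memJ[/colP].
have cJ x : (cnt x (flatten J) <= 1)%N.
  by rewrite -(cP x) cE addnCA leq_addr.
have [cB mB] := heads_measure colJ cJ.
set B := [set x | _] in cB mB.
have cv := colP _ vP; have [v0 kv _] := cv.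
(* The relation [sum k m = 0] leaves the slack [M B - M v = sum f m]
   with coefficients [f] that are nonnegative: either all of them vanish and
   [v] and [B] are equimeasured, or [v] is strictly smaller than [B] at
   every measure. *)
pose f w : int := k w + (if k w < 0 then M%:Z else 0).
have f0 w : w \in P' -> 0 <= f w.
  move=> /memP' /leM; rewrite -/(k w) /f; case: ifP; lia.
have slack i : \sum_(w <- P') (f w)%:~R * m i (head set0 w) =
    M%:R * (m i B - m i (head set0 v)).
  have := sum_excess tP cU cV dU dV i; rewrite UV subrr (perm_big _ pP)/=.
  rewrite big_cons vM => h.
  under eq_bigr do rewrite /f intrD mulrDl.
  rewrite big_split /= mB big_filter mulrBr.
  rewrite mulr_sumr; move: h => /eqP; rewrite addr_eq0 => /eqP h.
  rewrite -[X in _ - X]/(M%:~R * _) h opprK addrC; congr (_ + _).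
  rewrite [RHS]big_mkcond /=.
  by apply: eq_bigr => w _; case: ifP; rewrite ?mul0r.
have [C [cC CB CE]] : exists C, [/\ clopen C, C `<=` B &
    forall i, m i C = m i (head set0 v)].
  have MR : 0 < M%:R :> R by rewrite ltr0n.
  have [/hasP[w wP' fw]|/hasPn noF] := boolP (has (fun w => 0 < f w) P').
    apply: (good_family_good mG (column_clopen cv) cB) => i.
    rewrite -subr_gt0 -(pmulr_rgt0 _ MR) -slack (perm_big _ (perm_to_rem wP')).
    have pos u : u \in P' -> 0 < m i (head set0 u).
      move=> /memP' /colP cu; apply: m_pos; first exact: column_clopen.
      by case: cu.
    rewrite /= big_cons ltr_pwDl//; first by rewrite mulr_gt0 ?ltr0z ?pos.
    rewrite big_seq; apply: sumr_ge0 => u /mem_rem uP'.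
    by rewrite mulr_ge0 ?ler0z ?f0 ?ltW ?pos.
  exists B; split=> // i; apply/eqP; rewrite -subr_eq0.
  rewrite -(mulrI_eq0 _ (lregP (lt0r_neq0 MR))) -slack big_seq big1 // => w wP'.
  have := noF _ wP'; rewrite -leNgt => fw.
  by rewrite (@le_anti _ _ (f w) 0) ?mul0r// fw f0.
have kC : class C v by move=> a /kv[ca ea]; split=> // i; rewrite ea CE.
have [J1 [J2 [J1P J2P Jcount Jcnt _]]] := stack true colJ v0 cC kC CB.
have kslice s t : t \in P -> slice s t -> column s -> k s = k t.
  move=> tP' st cs; apply: excess_slice st cs _ _ => a a_t; [apply: dU|apply: dV];
    by apply/flattenP; exists t.
exists (J1 ++ J2 ++ N); split.
- split=> [w|x].
    rewrite !mem_cat => /or3P[/J1P[]//|/J2P[]//|/memN[/colP]//].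
  by rewrite -(cP x) cE catA flatten_cat cnt_cat Jcnt; lia.
- move=> w; rewrite !mem_cat => /or3P[||/memN[wP _]].
  + by move=> /J1P[_ [w0 /memJ[w0P _] s]]; exact: blocks_slice s.
  + move=> /J2P[_ [w0 [w1 [v1 [/memJ[w0P _] [_ s1] [_ s2] ->]]]]].
    by apply: blocks_cat; [exact: blocks_slice s1|exact: blocks_slice s2].
  + exact: refines_refl.
- move=> w; rewrite !mem_cat => /or3P[||/memN[/leM]//].
  + move=> /J1P[cw [w0 /memJ[w0P _] s]].
    by have := leM _ w0P; rewrite -!/(k _) (kslice _ _ w0P s cw).
  + move=> /J2P[_ [w0 [w1 [v1 [/memJ[w0P kw0] [c1 s1] [c2 s2] ->]]]]].
    have := leM _ w0P; rewrite excess_join -!/(k _).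
    rewrite (kslice _ _ w0P s1 c1) (kslice _ _ vP s2 c2) [k v]vM; lia.
- set p := fun w => _.
  have cp : count p P = count p (v :: J ++ N).
    by apply/permP; rewrite (perm_trans pP)// perm_cons.
  have pv : p v by rewrite /p vM /=.
  rewrite cp /= pv !count_cat.
  have -> : count p J2 = 0%N.
    rewrite -(@eq_in_count _ pred0) ?count_pred0// => w.
    move=> /J2P[_ [w0 [w1 [v1 [/memJ[w0P kw0] [c1 s1] [c2 s2] ->]]]]].
    have := leM _ w0P; rewrite /p excess_join -!/(k _).
    rewrite (kslice _ _ w0P s1 c1) (kslice _ _ vP s2 c2) [k v]vM /=; lia.
  have h : (count p J1 <= count p J)%N.
    apply: Jcount => s t /memJ[tP' _] st cs.
    by rewrite /p -!/(k _) (kslice _ _ tP' st cs).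
  lia.
Qed.

Lemma decides_refines A P Q : refines Q P ->
  (forall a, a \in flatten P -> decides A a) ->
  forall a, a \in flatten Q -> decides A a.
Proof.
move=> QP dA a /flattenP[w /QP Pw aw]; exact: decides_blocks dA Pw _ aw.
Qed.

(** Nested induction, on a bound for the absolute excesses and on the number of columns attaining
    it. *)
Lemma tower_balance U V P : clopen U -> clopen V -> equiv U V ->
  tower P -> (forall a, a \in flatten P -> decides U a) ->
  (forall a, a \in flatten P -> decides V a) ->
  exists Q, [/\ tower Q, refines Q P & forall w, w \in Q -> num U w = num V w].
Proof.
move=> cU cV UV tP dU dV.
have [M leM] : exists M : nat, forall w, w \in P -> (`|excess U V w| <= M)%N.
  exists (\sum_(w <- P) `|excess U V w|)%N => w wP.
  by rewrite (perm_big _ (perm_to_rem wP))/= big_cons; lia.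
elim: M P tP dU dV leM => [|M IHM] P tP dU dV leM.
  exists P; split=> //; first exact: refines_refl.
  by move=> w /leM; rewrite /excess; lia.
pose bad Q := count (fun w => (`|excess U V w| == M.+1)%N) Q.
have [n] := ubnP (bad P); elim: n P tP dU dV leM => // n IHn P tP dU dV leM leP.
have [|] := boolP (has (fun w => (`|excess U V w| == M.+1)%N) P); last first.
  move=> /hasPn h; apply: IHM => // w wP; have := leM _ wP; have := h _ wP.
  lia.
move=> /hasP[v vP /eqP vM].
have [Q [tQ QP leQ cQ]] : exists Q, [/\ tower Q, refines Q P,
    forall w, w \in Q -> (`|excess U V w| <= M.+1)%N & (bad Q < bad P)%N].
  have [v0|v0] := lerP 0 (excess U V v).
    by apply: (balance_step cU cV) vP _ => //; lia.
  (* A column of excess [- M.+1] becomes one of excess [M.+1] once [U] and [V] are exchanged. *)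
  have [||Q [tQ QP leQ cQ]] :=
    @balance_step V U M.+1 P v cV cU (fun i => esym (UV i)) tP dV dU _ isT vP.
  - by move=> w /leM; rewrite excessC abszN.
  - by rewrite excessC; lia.
  exists Q; split=> //; first by move=> w /leQ; rewrite excessC abszN.
  rewrite /bad; move: cQ; congr (_ < _)%N; apply: eq_count => w;
    by rewrite excessC abszN.
have [|||Q' [tQ' Q'Q h]] := IHn Q tQ _ _ leQ.
- exact: decides_refines QP dU.
- exact: decides_refines QP dV.
- by apply: leq_trans cQ _; rewrite -ltnS.
by exists Q'; split=> //; exact: refines_trans QP.
Qed.

(** * The refining sequence and its transition relations *)

(** The third clause serves saturation. The last puts all bottoms on one side of [U], and likewise
    all tops; as [U] runs through the clopen sets, this shrinks them to points. *)
Definition adapted U V Q :=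
  [/\ forall a, a \in flatten Q -> decides U a,
      forall a, a \in flatten Q -> decides V a,
      equiv U V -> forall w, w \in Q -> num U w = num V w &
      forall b, (forall w, w \in Q -> endset b w `<=` U) \/
                (forall w, w \in Q -> endset b w `<=` ~` U)].

Lemma tower_neq0 P : tower P -> forall w, w \in P -> w != [::].
Proof. by move=> [colP _] w /colP[]. Qed.

Lemma endset_mem b s : s != [::] -> endset b s \in s.
Proof. by case: s b => // a s [] _ /=; rewrite ?mem_head ?mem_last. Qed.

Lemma endset_refines b P Q : tower P -> refines Q P ->
  forall w, w \in Q -> exists2 v, v \in P & endset b w `<=` endset b v.
Proof.
move=> /tower_neq0 P0 QP w /QP Pw.
by case: b; [apply: head_blocks|apply: last_blocks].
Qed.

(** After collapsing onto one column, every end lies in a single level of [P], which is already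
    decided. *)
Lemma tower_collapse_decides b A P : tower P ->
  (forall a, a \in flatten P -> decides A a) ->
  exists Q, [/\ tower Q, refines Q P &
    (forall w, w \in Q -> endset b w `<=` A) \/
    (forall w, w \in Q -> endset b w `<=` ~` A)].
Proof.
case: P => [|S P] tP dA.
  by exists [::]; split=> //; left.
have [Q [tQ QP h]] := tower_collapse b tP.
have [|bA|bA] := dA (endset b S).
- apply/flattenP; exists S; rewrite ?mem_head// endset_mem//.
  by apply: tower_neq0 tP _ _; rewrite mem_head.
- by exists Q; split=> //; left=> w /h wS; apply: subset_trans bA.
- by exists Q; split=> //; right=> w /h wS; apply: subset_trans bA.
Qed.

Lemma endset_subset_refines b A P Q : tower P -> refines Q P ->
  (forall w, w \in P -> endset b w `<=` A) ->
  forall w, w \in Q -> endset b w `<=` A.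
Proof.
move=> tP QP PA w /(endset_refines b tP QP)[v /PA vA wv].
exact: subset_trans vA.
Qed.

(** Decided levels and confined ends pass to every refinement, so the requirements can be met one
    after another, with balancing last. *)
Lemma tower_step U V P : clopen U -> clopen V -> tower P ->
  exists Q, [/\ tower Q, refines Q P & adapted U V Q].
Proof.
move=> cU cV tP.
have [P1 [t1 r1 dU]] := tower_decides cU tP.
have [P2 [t2 r2 dV]] := tower_decides cV t1.
have {}dU := decides_refines r2 dU.
have [P3 [t3 r3 e3]] := tower_collapse_decides true t2 dU.
have {}dU := decides_refines r3 dU; have {}dV := decides_refines r3 dV.
have [P4 [t4 r4 e4]] := tower_collapse_decides false t3 dU.
have {}dU := decides_refines r4 dU; have {}dV := decides_refines r4 dV.
have [P5 [t5 r5 bal]] : exists Q, [/\ tower Q, refines Q P4 &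
    equiv U V -> forall w, w \in Q -> num U w = num V w].
  have [UV|nUV] := pselect (equiv U V).
    by have [Q [? ? ?]] := tower_balance cU cV UV t4 dU dV; exists Q.
  by exists P4; split=> //; exact: refines_refl.
exists P5; split=> //.
  apply: refines_trans r5 _; apply: refines_trans r4 _; apply: refines_trans r3 _.
  exact: refines_trans r2 _.
split=> //; first exact: decides_refines dU.
  exact: decides_refines dV.
have r53 := refines_trans r5 r4.
case; first by case: e3 => e3; [left|right]; apply: endset_subset_refines e3.
by case: e4 => e4; [left|right]; apply: endset_subset_refines e4.
Qed.

Lemma tower_sequence (E : nat -> set X * set X) :
  (forall n, clopen (E n).1 /\ clopen (E n).2) -> [set: X] !=set0 ->
  exists T : nat -> seq (seq (set X)), forall n,
    [/\ tower (T n), refines (T n.+1) (T n) & adapted (E n).1 (E n).2 (T n.+1)].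
Proof.
move=> cE X0.
have t0 : tower [:: [:: [set: X]]].
  split=> [w|x]; last by rewrite /cnt /= asboolT.
  rewrite inE => /eqP ->; split=> // a; rewrite inE => /eqP ->.
  by split=> //; exact: clopenT.
(* The stage is carried along because it selects the pair to which the next tower is adapted. *)
have step (nP : nat * {P | tower P}) : {Q : {P | tower P} |
    refines (sval Q) (sval nP.2) /\ adapted (E nP.1).1 (E nP.1).2 (sval Q)}.
  apply: cid; have [cU cV] := cE nP.1.
  have [Q [tQ QP aQ]] := tower_step cU cV (svalP nP.2).
  by exists (exist _ Q tQ).
pose T := nat_rect (fun=> {P | tower P}) (exist _ _ t0)
  (fun n (Q : {P | tower P}) => sval (step (n, Q))).
exists (fun n => sval (T n)) => n; split; first exact: svalP.
  by have [] := svalP (step (n, T n)).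
by have [] := svalP (step (n, T n)).
Qed.

(* Above the top levels the next level is not determined: any bottom level is
   allowed. *)
Definition arrow P x y :=
  (exists w j, [/\ w \in P, (j.+1 < size w)%N, nth set0 w j x &
     nth set0 w j.+1 y]) \/
  (exists w w', [/\ w \in P, w' \in P, last set0 w x & head set0 w' y]).

Lemma count_has_uniq (T : eqType) (p : pred T) (x0 : T) (s : seq T) i j :
  (count p s <= 1)%N -> (i < size s)%N -> (j < size s)%N ->
  p (nth x0 s i) -> p (nth x0 s j) -> i = j.
Proof.
elim: s i j => [|a s IH] [|i] [|j] //=.
- move=> c _ js pa pj.
  have : (0 < count p s)%N.
    by rewrite -has_count; apply/hasP; exists (nth x0 s j); rewrite ?mem_nth.
  by rewrite pa in c; move: c; lia.
- move=> c js _ pj pa.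
  have : (0 < count p s)%N.
    by rewrite -has_count; apply/hasP; exists (nth x0 s i); rewrite ?mem_nth.
  by rewrite pa in c; move: c; lia.
- by move=> c is_ js pi pj; congr S; apply: IH => //; lia.
Qed.

Section Arrow.
Context {P} (tP : tower P).

Let colP := tP.1.
Let cP := tP.2.

Lemma tower_cover x : exists w j,
  [/\ w \in P, (j < size w)%N & nth set0 w j x].
Proof.
have : has (fun a => `[< a x >]) (flatten P) by rewrite has_count -/(cnt _ _) cP.
move=> /hasP[a /flattenP[w wP aw] /asboolP ax].
by exists w, (index a w); rewrite index_mem aw nth_index.
Qed.

Lemma tower_uniq x w j w' j' : w \in P -> w' \in P ->
  (j < size w)%N -> (j' < size w')%N ->
  nth set0 w j x -> nth set0 w' j' x -> w = w' /\ j = j'.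
Proof.
move=> wP wP' jw jw' wx wx'.
have cE := cP x; rewrite (flatten_perm_cnt _ (perm_to_rem wP)) /= cnt_cat in cE.
have cw0 v i : (i < size v)%N -> nth set0 v i x -> (0 < cnt x v)%N.
  move=> iv vx; rewrite /cnt -has_count; apply/hasP; exists (nth set0 v i).
    exact: mem_nth.
  exact/asboolP.
have [ww'|nw] := eqVneq w w'.
  split=> //; rewrite -ww' in jw' wx'.
  apply: (@count_has_uniq _ (fun a => `[< a x >]) set0 w) => //; try exact/asboolP.
  by rewrite -cE leq_addr.
have wr : w' \in rem w P.
  by move: wP'; rewrite (perm_mem (perm_to_rem wP)) inE eq_sym (negPf nw).
move: cE; rewrite (flatten_perm_cnt _ (perm_to_rem wr)) /= cnt_cat.
by have := cw0 _ _ jw wx; have := cw0 _ _ jw' wx'; lia.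
Qed.

Lemma tower_nth w j : w \in P -> (j < size w)%N ->
  [/\ clopen (nth set0 w j), nth set0 w j !=set0 & nth set0 w j \in flatten P].
Proof.
move=> wP jw; have jm := mem_nth set0 jw.
have [? _ ?] := column_mem (colP wP) jm; split=> //.
by apply/flattenP; exists w.
Qed.

Lemma tower_size w : w \in P -> (0 < size w)%N.
Proof. by move=> wP; rewrite lt0n size_eq0; exact: tower_neq0 wP. Qed.

Lemma arrow_next x y w j : arrow P x y -> w \in P -> (j.+1 < size w)%N ->
  nth set0 w j x -> nth set0 w j.+1 y.
Proof.
move=> [[v [i [vP iv vx vy]]]|[v [v' [vP vP' vx vy]]]] wP jw wx.
  by have [<- <-] := tower_uniq vP wP (ltnW iv) (ltnW jw) vx wx.
rewrite -nth_last in vx.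
have [|wv jv] := tower_uniq vP wP _ (ltnW jw) vx wx.
  by have := tower_size vP; lia.
by move: jw; rewrite -wv -jv; have := tower_size vP; lia.
Qed.

Lemma arrow_last x y w : arrow P x y -> w \in P -> last set0 w x ->
  exists2 w', w' \in P & head set0 w' y.
Proof.
move=> [[v [i [vP iv vx vy]]]|[v [v' [vP vP' vx vy]]]] wP wx; last by exists v'.
rewrite -nth_last in wx.
have [|wv jv] := tower_uniq vP wP (ltnW iv) _ vx wx.
  by have := tower_size wP; lia.
by move: iv; rewrite wv jv; have := tower_size wP; lia.
Qed.

Lemma arrow_prev x y w j : arrow P x y -> w \in P -> (j.+1 < size w)%N ->
  nth set0 w j.+1 y -> nth set0 w j x.
Proof.
move=> [[v [i [vP iv vx vy]]]|[v [v' [vP vP' vx vy]]]] wP jw wy.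
  by have [<- [<-]] := tower_uniq vP wP iv jw vy wy.
rewrite -nth0 in vy.
by have [_] := tower_uniq vP' wP (tower_size vP') jw vy wy.
Qed.

Lemma arrow_head x y w : arrow P x y -> w \in P -> head set0 w y ->
  exists2 w', w' \in P & last set0 w' x.
Proof.
move=> [[v [i [vP iv vx vy]]]|[v [v' [vP vP' vx vy]]]] wP wy; last by exists v.
rewrite -nth0 in wy.
by have [] := tower_uniq vP wP iv (tower_size wP) vy wy.
Qed.

Lemma arrow_total x : exists y, arrow P x y.
Proof.
have [w [j [wP jw wx]]] := tower_cover x.
have [jw'|jw'] := ltnP j.+1 (size w).
  by have [_ [y wy] _] := tower_nth wP jw'; exists y; left; exists w, j.
have [_ [y wy] _] := tower_nth wP (tower_size wP).
exists y; right; exists w, w; split=> //.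
by rewrite -nth_last (_ : _.-1 = j)//; lia.
Qed.

Lemma arrow_surj y : exists x, arrow P x y.
Proof.
have [w [[|j] [wP jw wy]]] := tower_cover y; last first.
  by have [_ [x wx] _] := tower_nth wP (ltnW jw); exists x; left; exists w, j.
have [|_ [x wx] _] := @tower_nth w (size w).-1 wP; first by lia.
by exists x; right; exists w, w; rewrite -nth_last -nth0.
Qed.

(** The successors of a point depend only on its level. As levels are open, this gives the local
    constancy asked for by the limit construction. *)
Lemma arrow_congl x x' y w j : w \in P -> (j < size w)%N ->
  nth set0 w j x -> nth set0 w j x' -> arrow P x y -> arrow P x' y.
Proof.
move=> wP jw wx wx' xy.
have [jw'|jw'] := ltnP j.+1 (size w).
  by left; exists w, j; split=> //; exact: arrow_next wx.
have jE : j = (size w).-1 by lia.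
rewrite jE nth_last in wx wx'.
have [w' wP' wy] := arrow_last xy wP wx.
by right; exists w, w'.
Qed.

Lemma arrow_congr x y y' w j : w \in P -> (j < size w)%N ->
  nth set0 w j y -> nth set0 w j y' -> arrow P x y -> arrow P x y'.
Proof.
move=> wP jw wy wy' xy; case: j => [|j] in jw wy wy' *.
  rewrite nth0 in wy wy'; have [w' wP' wx] := arrow_head xy wP wy.
  by right; exists w', w.
by left; exists w, j; split=> //; exact: arrow_prev wy.
Qed.

Lemma tower_near x : \forall x' \near x, forall w j, w \in P -> (j < size w)%N ->
  nth set0 w j x -> nth set0 w j x'.
Proof.
have [w [j [wP jw wx]]] := tower_cover x.
have [[oa _] _ _] := tower_nth wP jw.
apply: filterS (open_nbhs_nbhs (conj oa wx)) => x' wx' v i vP iv vx.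
by have [<- <-] := tower_uniq wP vP jw iv wx vx.
Qed.

Lemma arrow_nearl x : \forall x' \near x, forall y, arrow P x y <-> arrow P x' y.
Proof.
have [w [j [wP jw wx]]] := tower_cover x.
apply: filterS (tower_near x) => x' /(_ _ _ wP jw wx) wx' y.
by split; apply: arrow_congl wP jw _ _.
Qed.

Lemma arrow_nearr y : \forall y' \near y, forall x, arrow P x y <-> arrow P x y'.
Proof.
have [w [j [wP jw wy]]] := tower_cover y.
apply: filterS (tower_near y) => y' /(_ _ _ wP jw wy) wy' x.
by split; apply: arrow_congr wP jw _ _.
Qed.

(** Below the top, all successors lie in one decided level; from the top, they lie in bottom levels,
    which are all on the same side of [U]. *)
Lemma arrow_decidesr U V : adapted U V P -> forall x,
  (forall y, arrow P x y -> U y) \/ (forall y, arrow P x y -> ~ U y).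
Proof.
move=> [dU _ _ end_] x; have [w [j [wP jw wx]]] := tower_cover x.
have [jw'|jw'] := ltnP j.+1 (size w).
  have [_ _ /dU[h|h]] := tower_nth wP jw'; [left|right] => y xy;
    by apply: h; exact: arrow_next wx.
have jE : j = (size w).-1 by lia.
rewrite jE nth_last in wx.
by case: (end_ true) => h; [left|right] => y xy;
  have [v vP vy] := arrow_last xy wP wx; exact: h vP _ vy.
Qed.

Lemma arrow_decidesl U V : adapted U V P -> forall y,
  (forall x, arrow P x y -> U x) \/ (forall x, arrow P x y -> ~ U x).
Proof.
move=> [dU _ _ end_] y; have [w [[|j] [wP jw wy]]] := tower_cover y; last first.
  have [_ _ /dU[h|h]] := tower_nth wP (ltnW jw); [left|right] => x xy;
    by apply: h; exact: arrow_prev wy.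
rewrite nth0 in wy.
by case: (end_ false) => h; [left|right] => x xy;
  have [v vP vx] := arrow_head xy wP wy; exact: h vP _ vx.
Qed.

(** Consecutive levels either lie in the same slice of a column of [P] or meet at a seam, where a
    top of [P] is followed by a bottom. *)
Lemma arrow_blocks x y w j : blocks P w -> (j.+1 < size w)%N ->
  nth set0 w j x -> nth set0 w j.+1 y -> arrow P x y.
Proof.
have P0 := tower_neq0 tP.
move=> Pw; elim: Pw j => [s t tP' [st h]|s t Ps IHs Pt IHt] j jw wx wy.
  by left; exists t, j; split; rewrite -?st//; exact: h.
have [js|js] := ltnP j.+1 (size s).
  apply: (IHs j) => //.
    by move: wx; rewrite nth_cat (ltnW js).
  by move: wy; rewrite nth_cat js.
have [js'|js'] := ltnP j (size s); last first.
  apply: (IHt (j - size s)%N).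
  - by move: jw; rewrite size_cat; lia.
  - by move: wx; rewrite nth_cat ltnNge js'.
  - by move: wy; rewrite nth_cat ltnNge js -subSn.
have jE : j = (size s).-1 by lia.
have [v vP sv] := last_blocks P0 Ps; have [v' vP' tv] := head_blocks P0 Pt.
right; exists v, v'; split=> //.
  by apply: sv; move: wx; rewrite nth_cat js' jE nth_last.
by apply: tv; move: wy; rewrite nth_cat ltnNge js -nth0 (_ : _ - _ = 0)%N//; lia.
Qed.

End Arrow.

Lemma arrow_refines P Q x y : tower P -> refines Q P ->
  arrow Q x y -> arrow P x y.
Proof.
move=> tP QP [[w [j [wQ jw wx wy]]]|[w [w' [wQ wQ' wx wy]]]].
  exact: (arrow_blocks tP (QP _ wQ) jw).
have [v vP wv] := @endset_refines false _ _ tP QP _ wQ.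
have [v' vP' wv'] := @endset_refines true _ _ tP QP _ wQ'.
by right; exists v, v'; split=> //; [exact: wv|exact: wv'].
Qed.

(** As far as [A] can tell, [g] rotates each column: a level lies in the preimage of [A] exactly
    when the cyclically next one lies in [A]. Both sets thus contain equally many levels of each
    column. *)
Lemma arrow_equiv A V P (g : X -> X) : tower P -> clopen A ->
  clopen (g @^-1` A) -> adapted A V P -> (forall x, arrow P x (g x)) ->
  equiv (g @^-1` A) A.
Proof.
move=> tP cA cA' [dA _ _ end_] gP i.
have [colP _] := tP.
have key w j : w \in P -> (j < size w)%N ->
    let a := nth set0 w j in let b := nth set0 (rot 1 w) j in
    (a `<=` g @^-1` A /\ b `<=` A) \/ (a `<=` ~` (g @^-1` A) /\ b `<=` ~` A).
  move=> wP jw a b.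
  have w0 := tower_neq0 tP wP.
  have bE : b = nth set0 (rcons (behead w) (head set0 w)) j.
    by rewrite /b; case: w w0 {wP jw a b} => // c s _; rewrite rot1_cons.
  have [jw'|jw'] := ltnP j.+1 (size w).
    have bE' : b = nth set0 w j.+1.
      by rewrite bE nth_rcons nth_behead size_behead; case: ltnP => //; lia.
    have [_ _] := tower_nth tP wP jw'; rewrite -bE' => /dA[bA|bA];
      [left|right]; split=> // x ax /=; have := bA (g x); rewrite bE'; apply;
      exact: (arrow_next tP (gP x) wP jw' ax).
  have jE : j = (size w).-1 by lia.
  have bE' : b = head set0 w.
    by rewrite bE nth_rcons size_behead jE ltnn eqxx.
  have aE : a = last set0 w by rewrite /a jE nth_last.
  (* From the top, [g] may lead to the bottom of another column, but all bottoms lie on the same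
     side of [A]. *)
  rewrite bE' aE; case: (end_ true) => h; [left|right]; split; try exact: h;
    by move=> x ax; have [v vP vy] := arrow_last tP (gP x) wP ax; exact: h vP _ vy.
rewrite (measure_num tP cA')//; last first.
  move=> a /flattenP[w wP aw].
  have := key w (index a w) wP; rewrite index_mem aw nth_index// => /(_ isT).
  by case=> -[h _]; [left|right].
rewrite (measure_num tP cA)//; apply: eq_big_seq => w wP; congr (_%:R * _).
have <- : num A (rot 1 w) = num A w by apply/permP; rewrite perm_rot.
have countE (p : pred (set X)) s : count p s = count id [seq p a | a <- s].
  by rewrite count_map.
rewrite /num !countE; congr count.
apply: (@eq_from_nth _ false) => [|j]; rewrite !size_map ?size_rot// => jw.
rewrite !(nth_map set0) ?size_rot//.
have [_ [x wx] _] := tower_nth tP wP jw.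
have [z bz] : nth set0 (rot 1 w) j !=set0.
  have jr : (j < size (rot 1 w))%N by rewrite size_rot.
  by have := mem_nth set0 jr; rewrite mem_rot => /(column_mem (colP _ wP))[].
have [[aA bA]|[aA bA]] := key w j wP jw; first by rewrite !asboolT.
rewrite !asboolF// => h.
  exact: (bA _ bz (h _ bz)).
exact: (aA _ wx (h _ wx)).
Qed.

End Measured.
End Towers.

(** * The limit homeomorphism and its full group *)

Section Saturation.
Context {R : realType} {X : ptopologicalType} {I : Type} (m : I -> set X -> R).
Context (mG : good_family m).
Implicit Types (U V : set X) (P : seq (seq (set X))).

Lemma arrow_iter P (g : homeo X X) w : tower m P -> w \in P ->
  (forall x, arrow P x (g x)) -> forall i j x, (i < size w)%N -> (j < size w)%N ->
  nth set0 w i x -> nth set0 w j (homeo_pow g (j%:Z - i%:Z) x).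
Proof.
move=> tP wP gP i j x.
have up k : forall i x, (i + k < size w)%N -> nth set0 w i x ->
    nth set0 w (i + k)%N (iter k g x).
  elim: k => [|k IH] {}i {}x ik wx; first by rewrite addn0.
  rewrite addnS in ik *; rewrite iterS; apply: (arrow_next tP (gP _) wP ik).
  by apply: IH => //; lia.
have down k : forall i x, (i + k < size w)%N -> nth set0 w (i + k)%N x ->
    nth set0 w i (iter k (homeo_inv g) x).
  elim: k => [|k IH] {}i {}x ik wx; first by rewrite addn0 in wx.
  rewrite iterSr; apply: IH; first by lia.
  rewrite addnS in ik wx.
  apply: (arrow_prev tP _ wP ik wx).
  by have := gP (homeo_inv g x); rewrite homeo_invK.
move=> iw jw wx; have [ij|ji] := leqP i j.
  rewrite (_ : _ - _ = Posz (j - i)); last by lia.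
  by have := up (j - i)%N i x; rewrite subnKC//; apply.
(* [Negz n] stands for [- n.+1], hence the predecessor. *)
rewrite (_ : _ - _ = Negz (i - j).-1); last by rewrite NegzE; lia.
rewrite /homeo_pow prednK ?subn_gt0//.
by apply: down; rewrite subnKC// ltnW.
Qed.

(** In each column an involution of the levels exchanges those in [U] with those in [V]. Moving from
    level [j] to level [f j] is the power [f j - j] of [g], constant on each level, so the levels
    form the partition required by the full group. *)
Lemma balanced_swap P (g : homeo X X) U V : tower m P ->
  (forall x, arrow P x (g x)) ->
  (forall a, a \in flatten P -> decides U a) ->
  (forall a, a \in flatten P -> decides V a) ->
  (forall w, w \in P -> num U w = num V w) ->
  exists2 h, topological_full_group g h & h @` U = V.
Proof.
move=> tP gP dU dV bal.
have /choice[f fP] (w : seq (set X)) : exists f : nat -> nat, w \in P ->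
    forall j, (j < size w)%N ->
    [/\ (f j < size w)%N, f (f j) = j,
      nth set0 w j `<=` U -> nth set0 w (f j) `<=` V &
      nth set0 w j `<=` V -> nth set0 w (f j) `<=` U].
  have [wP|nwP] := boolP (w \in P); last by exists id.
  have [f fP] := swap_involution set0 (bal _ wP).
  exists f => _ j /fP[h1 h2 h3 h4]; split=> //.
    by move=> /asboolP; rewrite -h4 => /asboolP.
  by move=> /asboolP; rewrite -h3 => /asboolP.
have /choice[c cP] (x : X) : exists wj : seq (set X) * nat,
    [/\ wj.1 \in P, (wj.2 < size wj.1)%N & nth set0 wj.1 wj.2 x].
  by have [w [j ?]] := tower_cover tP x; exists (w, j).
pose W x := (c x).1; pose J x := (c x).2.
have WJ x w j : w \in P -> (j < size w)%N -> nth set0 w j x -> W x = w /\ J x = j.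
  move=> wP jw wx; have [cP1 cP2 cP3] := cP x.
  exact: (tower_uniq tP cP1 wP cP2 jw cP3 wx).
pose k x : int := (f (W x) (J x))%:Z - (J x)%:Z.
pose h x := homeo_pow g (k x) x.
have hP x : nth set0 (W x) (f (W x) (J x)) (h x).
  by have [wP jw wx] := cP x; apply: (arrow_iter tP wP gP) => //;
    have [] := fP _ wP _ jw.
have hWJ x : W (h x) = W x /\ J (h x) = f (W x) (J x).
  have [wP jw wx] := cP x; have [fj _ _ _] := fP _ wP _ jw.
  exact: WJ (hP x).
(* The exponent at [h x] is the opposite of the exponent at [x], because [f] is an involution. *)
have hK : involutive h.
  move=> x; rewrite {1}/h {1}/k; have [-> ->] := hWJ x.
  have [wP jw wx] := cP x; have [_ -> _ _] := fP _ wP _ jw.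
  by rewrite -opprB homeo_powK.
have kE x y w j : w \in P -> (j < size w)%N -> nth set0 w j x ->
    nth set0 w j y -> k x = k y.
  move=> wP jw wx wy; rewrite /k.
  by have [-> ->] := WJ _ _ _ wP jw wx; have [-> ->] := WJ _ _ _ wP jw wy.
have ch : continuous h.
  move=> x N hN0.
  have hN : nbhs x (homeo_pow g (k x) @^-1` N) by exact: homeo_pow_continuous hN0.
  have [wP jw wx] := cP x.
  apply: (@filterS _ (nbhs x) _ _ _ _ (filterI hN (tower_near mG tP x))) => y.
  move=> [Ny /(_ _ _ wP jw wx) wy].
  by rewrite /h /= -(kE x y _ _ wP jw wx wy).
exists (Homeo hK hK ch ch); last first.
  have UV x : U x -> V (h x).
    have [wP jw wx] := cP x => Ux; have [_ _ fU _] := fP _ wP _ jw.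
    have [_ _ /dU[wU|/(_ _ wx)//]] := tower_nth mG tP wP jw.
    exact: fU wU _ (hP x).
  have VU x : V x -> U (h x).
    have [wP jw wx] := cP x => Vx; have [_ _ _ fV] := fP _ wP _ jw.
    have [_ _ /dV[wV|/(_ _ wx)//]] := tower_nth mG tP wP jw.
    exact: fV wV _ (hP x).
  rewrite predeqE => y; split=> [[x /UV Vx <-]//|/VU Uy].
  by exists (h y) => //=; exact: hK.
pose A (i : 'I_(size (flatten P))) := nth set0 (flatten P) i.
have AP i : exists w j, [/\ w \in P, (j < size w)%N & A i = nth set0 w j].
  have /flattenP[w wP aw] := mem_nth set0 (ltn_ord i).
  by exists w, (index (A i) w); rewrite index_mem nth_index.
have A0 i : A i !=set0.
  by have [w [j [wP jw ->]]] := AP i; have [] := tower_nth mG tP wP jw.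
have /choice[p pP] := A0.
(* The exponent on a level is read off at a chosen point [p i] of it. *)
exists (size (flatten P)), A, (fun i => k (p i)); split.
- split=> //.
  + rewrite predeqE => x; split=> // _.
    have [wP jw wx] := cP x; have [_ _ am] := tower_nth mG tP wP jw.
    have ia : (index (nth set0 (W x) (J x)) (flatten P) < size (flatten P))%N.
      by rewrite index_mem.
    by exists (Ordinal ia); rewrite // /A /= nth_index.
  + move=> i j _ _ [x [Aix Ajx]]; apply: val_inj.
    apply: (@count_has_uniq _ (fun a => `[< a x >]) set0 (flatten P));
      [by rewrite -/(cnt _ _) tP.2|exact: ltn_ord|exact: ltn_ord
      |exact/asboolP|exact/asboolP].
- by move=> i; have [w [j [wP jw ->]]] := AP i; have [] := tower_nth mG tP wP jw.
- move=> i x Aix /=; rewrite /h; congr homeo_pow.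
  have := pP i; have [w [j [wP jw AE]]] := AP i; rewrite AE in Aix *.
  by move=> px; exact: kE wP jw Aix px.
Qed.

(** The towers are adapted in turn to all pairs of clopen sets. Pairs [(A, A)] make the transitions
    converge and give invariance of [A]; pairs [(U, V)] give saturation. *)
Lemma saturated_homeo_exists (E : nat -> set X) : compact [set: X] ->
  hausdorff_space X -> zero_dimensional X ->
  (forall n, clopen (E n)) -> (forall A, clopen A -> exists n, E n = A) ->
  exists g : homeo X X, (forall A, clopen A -> equiv m (g @^-1` A) A) /\
    forall U V, clopen U -> clopen V -> equiv m U V ->
    exists2 h, topological_full_group g h & h @` U = V.
Proof.
move=> cX hX zX cE surjE.
pose F n := if unpickle n is Some (i, j) then (E i, E j) else (E 0%N, E 0%N).
have cF n : clopen (F n).1 /\ clopen (F n).2.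
  by rewrite /F; case: unpickle => [[i j]|]; split; exact: cE.
have surjF U V : clopen U -> clopen V -> exists n, F n = (U, V).
  move=> /surjE[i <-] /surjE[j <-]; exists (pickle (i, j)).
  by rewrite /F pickleK.
have [|T TP] := tower_sequence mG cF; first by exists point.
have tT n : tower m (T n) by have [] := TP n.
have [|||||A cA|A cA|g gP] := @limit_homeo X cX hX zX (fun n => arrow (T n)).
- move=> n x y; apply: (arrow_refines (tT n)).
  by have [] := TP n.
- by move=> n; exact: (arrow_total mG (tT n)).
- by move=> n; exact: (arrow_surj mG (tT n)).
- by move=> n; exact: (arrow_nearl mG (tT n)).
- by move=> n; exact: (arrow_nearr mG (tT n)).
- have [n Fn] := surjF _ _ cA cA; exists n.+1; have [_ _] := TP n.
  by rewrite Fn => aA; exact: (arrow_decidesr mG (tT n.+1) aA).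
- have [n Fn] := surjF _ _ cA cA; exists n.+1; have [_ _] := TP n.
  by rewrite Fn => aA; exact: (arrow_decidesl mG (tT n.+1) aA).
exists g; split=> [A cA|U V cU cV UV].
  have [n Fn] := surjF _ _ cA cA; have [_ _] := TP n; rewrite Fn => aA.
  apply: (arrow_equiv mG (tT n.+1) cA _ aA) => //.
  by apply: preimage_clopen => //; exact: homeo_fun_continuous.
have [n Fn] := surjF _ _ cU cV; have [_ _] := TP n; rewrite Fn => -[dU dV bal _].
exact: (balanced_swap (tT n.+1) (gP n.+1) dU dV (bal UV)).
Qed.

End Saturation.

(** * Clopen sets and measures on a Cantor space *)

Section Cylinders.
Context {X : topologicalType} (cX : compact [set: X]) (D : nat -> set X).
Context (cD : forall n, clopen (D n))
  (sepD : forall x y, x <> y -> exists n, ~ (D n x <-> D n y)).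

Definition trace n x : n.-tuple bool := [tuple `[< D i x >] | i < n].

Definition cylinder n x : set X := [set y | trace n y = trace n x].

Lemma traceP n x y :
  trace n x = trace n y <-> forall i, (i < n)%N -> (D i x <-> D i y).
Proof.
split=> [E i i_n|h].
  have := congr1 (fun t => tnth t (Ordinal i_n)) E; rewrite !tnth_mktuple /= => e.
  by split=> /asboolP; [rewrite e|rewrite -e] => /asboolP.
apply: eq_from_tnth => i; rewrite !tnth_mktuple; apply: asbool_equiv_eq.
exact: h.
Qed.

Lemma near_clopen (A : set X) : clopen A ->
  forall x, \forall y \near x, A y <-> A x.
Proof.
move=> [oA cA] x; have [Ax|nAx] := pselect (A x).
  by apply: filterS (open_nbhs_nbhs (conj oA Ax)) => y.
by apply: filterS (open_nbhs_nbhs (conj (closed_openC cA) nAx)) => y; split.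
Qed.

Lemma near_trace n x : \forall y \near x, trace n y = trace n x.
Proof.
have : \forall y \near x, forall i : 'I_n, D i y <-> D i x.
  by apply: filter_forall => i; exact: near_clopen.
by apply: filterS => y h; apply/traceP => i i_n; exact: (h (Ordinal i_n)).
Qed.

Lemma trace_mono k n x y : (k <= n)%N -> trace n x = trace n y ->
  trace k x = trace k y.
Proof.
by move=> kn /traceP h; apply/traceP => i ik; apply: h; exact: leq_trans kn.
Qed.

Lemma trace_clopen n t : clopen [set x | trace n x = t].
Proof.
split; first by rewrite openE => x /= <-; exact: near_trace.
rewrite -openC openE => x /= nx; rewrite /interior.
by apply: filterS (near_trace n x) => y /= ->.
Qed.

(** Finitely many of the neighbourhoods cover [K], and the largest of their stages serves
    everywhere. *)
Lemma compact_near_nat (T : topologicalType) (K : set T) (P : nat -> T -> Prop) :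
  compact K ->
  (forall x, K x -> exists k, \forall y \near x,
    forall n, (k <= n)%N -> P n y) ->
  exists n, forall x, K x -> P n x.
Proof.
move=> /compact_near_coveringP/(_ nat \oo P _) cK h.
have [x Kx|N _ HN] := cK.
  have [k hk] := h x Kx.
  exists ([set y | forall n, (k <= n)%N -> P n y], [set n | (k <= n)%N]).
    by split=> //=; exists k.
  by move=> [y n] [/= hy kn]; exact: hy.
by exists N => x Kx; exact: HN (leqnn N) x Kx.
Qed.

(** Compactness is used twice: to bound the number of coordinates that keep a given point of [A]
    away from the complement, then to make this bound uniform in the point. *)
Lemma clopen_trace A : clopen A ->
  exists n, forall x y, trace n x = trace n y -> A x -> A y.
Proof.
move=> cA.
have [|n hn] := @compact_near_nat _ _
  (fun n x => forall y, trace n x = trace n y -> A x -> A y) cX.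
  move=> x _; have [Ax|nAx] := pselect (A x); last first.
    by exists 0%N; apply: filterS (near_clopen cA x) => x' h n _ y _ /h /nAx.
  have [k hk] : exists k, forall y, [set: X] y -> trace k x = trace k y -> A y.
    apply: compact_near_nat cX _ => y _; have [Ay|nAy] := pselect (A y).
      by exists 0%N; apply: filterS (near_clopen cA y) => y' h n _ _; exact/h.
    have [|i hi] := @sepD x y; first by move=> xy; rewrite xy in Ax.
    exists i.+1; apply: filterS (near_clopen (cD i) y) => y' h n i_n /traceP.
    by move=> /(_ _ i_n) xy'; case: hi; rewrite xy'.
  exists k; apply: filterS (near_trace k x) => x' xx' n kn y /(trace_mono kn) x'y _.
  by apply: hk => //; rewrite -xx'.
by exists n => x y; exact: hn.
Qed.

(** A clopen set is determined by a length [k] and a finite set of traces of that length; such pairs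
    form a countable type. *)
Lemma clopen_enumeration : exists E : nat -> set X,
  (forall n, clopen (E n)) /\ forall A, clopen A -> exists n, E n = A.
Proof.
pose F n : set X :=
  if unpickle n is Some nS then
    let: existT k s := (nS : {k : nat & {set k.-tuple bool}}) in
    [set x | trace k x \in s]
  else set0.
exists F; split=> [n|A cA].
  rewrite /F; case: unpickle => [[k S]|]; last exact: clopen0.
  split.
    rewrite openE => x /= xS; rewrite /interior.
    by apply: filterS (near_trace k x) => y /= ->.
  rewrite -openC openE => x /= xS; rewrite /interior.
  by apply: filterS (near_trace k x) => y /= ->.
have [k hk] := clopen_trace cA.
pose S := [set t : k.-tuple bool | `[< exists2 x, A x & trace k x = t >]]%SET.
exists (pickle (existT (fun k => {set k.-tuple bool}) k S)).
rewrite /F pickleK /= predeqE => x; rewrite /= inE; split.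
  by move=> /asboolP[y Ay yx]; exact: hk yx Ay.
by move=> Ax; apply/asboolP; exists x.
Qed.

Lemma bigcap_cylinder x : \bigcap_n cylinder n x = [set x].
Proof.
rewrite predeqE => y; split=> [h|->//].
apply: contrapT => /= /eqP/eqP yx; have [n] := sepD yx; apply.
by have /traceP := h n.+1 I; apply.
Qed.

Lemma cylinder_partition n A : clopen A -> exists bs : seq (set X),
  [/\ forall b, b \in bs -> clopen b,
      forall b, b \in bs -> b = set0 \/ exists x, b `<=` cylinder n x &
      forall x, count (fun b => `[< b x >]) bs = `[< A x >]].
Proof.
move=> cA.
exists [seq A `&` [set x | trace n x = t] | t <- enum {: n.-tuple bool}]; split.
- by move=> b /mapP[t _ ->]; apply: clopenI => //; exact: trace_clopen.
- move=> b /mapP[t _ ->]; set B := _ `&` _.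
  have [->|/set0P[x [_ xt]]] := eqVneq B set0; first by left.
  by right; exists x => y [_ /= yt]; rewrite /cylinder /= yt.
- move=> x; rewrite count_map; case: asboolP => Ax; last first.
    rewrite -(@eq_count _ pred0) ?count_pred0// => t /=.
    by rewrite asboolF// => -[].
  rewrite (@eq_count _ _ (pred1 (trace n x))).
    by rewrite count_uniq_mem ?enum_uniq// mem_enum.
  move=> t /=; apply/asboolP/eqP => [[_ ->]//|->]; split=> //.
Qed.

End Cylinders.

Section Coordinates.
Context {X : topologicalType} (phi : homeo X cantor_space).

Definition coordinate n : set X := [set x | (phi x : nat -> bool) n].

Lemma coordinate_clopen n : clopen (coordinate n).
Proof.
have -> : coordinate n =
    (fun x => (phi x : nat -> bool) n) @^-1` [set true].
  by rewrite predeqE => x; split.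
apply: preimage_clopen.
  by split; [exact: discrete_open|exact: discrete_closed].
move=> x; apply: (@continuous_comp _ _ _ phi (proj n)).
  exact: homeo_fun_continuous.
exact: proj_continuous.
Qed.

Lemma coordinate_sep x y : x <> y ->
  exists n, ~ (coordinate n x <-> coordinate n y).
Proof.
move=> xy; apply: contrapT => /forallNP h; apply: xy.
rewrite -(homeo_funK phi x) -(homeo_funK phi y); congr homeo_inv.
apply: funext => n; have /contrapT := h n; rewrite /coordinate /=.
by move=> [a b]; apply/idP/idP.
Qed.

Lemma homeo_cantor_compact : compact [set: X].
Proof.
have -> : [set: X] = homeo_inv phi @` [set: cantor_space].
  by rewrite predeqE => x; split=> // _; exists (phi x); rewrite ?homeo_funK.
apply: continuous_compact; last exact: cantor_space_compact.
exact/continuous_subspaceT/homeo_inv_continuous.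
Qed.

Lemma homeo_cantor_zero_dimensional : zero_dimensional X.
Proof.
move=> x y /eqP/coordinate_sep[n nxy].
have [xn|nxn] := pselect (coordinate n x).
  exists (coordinate n); split=> //; first exact: coordinate_clopen.
  by move=> yn; apply: nxy.
exists (~` coordinate n); split=> //; last by move=> yn; apply: nxy; split.
exact: (clopenC set0 (coordinate_clopen n)).
Qed.

Lemma zero_dimensional_hausdorff : zero_dimensional X -> hausdorff_space X.
Proof.
move=> zX; rewrite open_hausdorff => x y /zX[A [[oA cA] Ax nAy]].
exists (A, ~` A); rewrite ?inE//; split=> //=; last by rewrite setICr.
exact: closed_openC.
Qed.

End Coordinates.

(** * From a dynamical simplex to a good family *)

Section Measures.
Context {R : realType} {X : ptopologicalType}.
Implicit Types (K : set (borel_probability R X)) (mu : borel_probability R X)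
  (A B : set X).

Lemma open_borel A : open A -> measurable (A : set (borel X)).
Proof. exact: sub_sigma_algebra. Qed.

Lemma clopen_borel A : clopen A -> measurable (A : set (borel X)).
Proof. by case=> /open_borel. Qed.

Definition mass mu A : R := fine (mu A).

Lemma massE mu A : clopen A -> mu A = (mass mu A)%:E.
Proof. by move=> cA; rewrite fineK// fin_num_measure//; exact: clopen_borel. Qed.

(** The indicator function of a clopen set is continuous, so the mass is one of the evaluations
    defining the topology. *)
Lemma mass_continuous A : clopen A ->
  continuous (fun mu : weak_star => mass (mu : borel_probability R X) A).
Proof.
move=> cA.
pose f x : R := \1_A x.
have cf : continuous f.
  move=> x; have nA := near_clopen cA x.
  apply: (@cvg_trans _ (cst (f x) @ x)); last exact: cvg_cst.
  apply: near_eq_cvg; apply: filterS nA => y Ayx.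
  by rewrite /f /= !indicE (_ : (y \in A) = (x \in A))//;
    apply/idP/idP;
    rewrite !inE => /Ayx.
have -> : (fun mu : weak_star => mass (mu : borel_probability R X) A) =
    proj (mkcts cf : continuousType X R) \o weak_star_eval.
  apply: funext => mu; rewrite /= /proj /weak_star_eval /mass /Rintegral.
  by rewrite integral_indic ?setIT//; exact: clopen_borel.
move=> mu; apply: continuous_comp; first exact: initial_continuous.
exact: proj_continuous.
Qed.

(** Continuity from above: the cylinders decrease to the point [x], which has measure zero. *)
Lemma cylinder_mass_small mu (D : nat -> set X) :
  (forall n, clopen (D n)) ->
  (forall x y, x <> y -> exists n, ~ (D n x <-> D n y)) -> atomless mu ->
  forall x e, 0 < e -> exists k, mass mu (cylinder D k x) < e.
Proof.
move=> cD sepD amu x e e0.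
have mcyl n : measurable (cylinder D n x : set (borel X)).
  by apply: clopen_borel; exact: trace_clopen.
have fin0 : (mu (cylinder D 0 x) < +oo)%E.
  by rewrite massE ?ltry//; exact: trace_clopen.
have : mu (cylinder D n x) @[n --> \oo] --> mu (\bigcap_n cylinder D n x).
  apply: (@nonincreasing_cvg_mu _ (borel X) R mu (fun n => cylinder D n x)) => //.
  - exact: bigcap_measurable.
  - by move=> n k nk; apply/subsetPset => y; exact: trace_mono.
rewrite (bigcap_cylinder sepD) amu => /fine_cvg.
by move=> /(cvgr_lt 0)/(_ _ e0)[k _ /(_ k (leqnn k)) hk]; exists k.
Qed.

Lemma mass_family K (phi : homeo X cantor_space) : dynamical_simplex K ->
  good_family (fun (mu : {mu | K mu}) A => mass (sval mu) A).
Proof.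
move=> hK; have cX := homeo_cantor_compact phi.
pose D := coordinate phi.
have cD n : clopen (D n) by exact: coordinate_clopen.
have sepD x y : x <> y -> exists n, ~ (D n x <-> D n y).
  exact: coordinate_sep.
have pos mu A : K mu -> clopen A -> A !=set0 -> 0 < mass mu A.
  move=> Kmu cA A0; rewrite -lte_fin -massE//.
  by apply: (dynamical_simplex_full_support hK) => //; case: cA.
have le mu A B : clopen A -> clopen B -> A `<=` B -> mass mu A <= mass mu B.
  move=> cA cB AB; rewrite -lee_fin -!massE//.
  by apply: le_measure => //; rewrite inE; exact: clopen_borel.
split.
- by have [mu Kmu] := dynamical_simplex_nonempty hK; exists; exists mu.
- move=> [mu Kmu] A B cA cB AB /=; apply: EFin_inj.
  rewrite EFinD -!massE//; last exact: clopenU.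
  by rewrite measureU//; exact: clopen_borel.
- by move=> [mu Kmu] A; exact: pos.
- move=> A B cA cB AB.
  have [mu Kmu|C [cC CB CE]] := dynamical_simplex_good hK cA cB.
    by rewrite !massE// lte_fin; exact: (AB (exist _ mu Kmu)).
  by exists C; split=> // -[mu Kmu] /=; rewrite /mass CE.
- move=> A S cA cS S0.
  (* A cylinder length that works for all points and all measures: compactness of [K] handles one
     point, compactness of [X] all of them. *)
  have [|n hn] := @compact_near_nat _ _ (fun n x => forall mu, K mu ->
      mass mu (cylinder D n x) < mass mu S) cX.
    move=> x _.
    have [|k hk] := @compact_near_nat _ _ (fun n (mu : weak_star) =>
        mass (mu : borel_probability R X) (cylinder D n x) <
        mass (mu : borel_probability R X) S) (dynamical_simplex_compact hK).
      move=> mu Kmu.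
      have [k hk] := cylinder_mass_small cD sepD
        (dynamical_simplex_atomless hK Kmu) x (pos _ _ Kmu cS S0).
      exists k.
      (* Both masses are continuous in the measure, so the strict inequality at [mu] holds nearby,
         and longer cylinders only have less mass. *)
      pose H (nu : weak_star) : R := mass (nu : borel_probability R X) S -
        mass (nu : borel_probability R X) (cylinder D k x).
      have cH : H nu @[nu --> (mu : weak_star)] --> H mu.
        have c1 := mass_continuous cS.
        have c2 := mass_continuous (trace_clopen cD (trace D k x)).
        exact: (cvgB (c1 mu) (c2 mu)).
      have := cvgr_gt (H mu) cH; rewrite /H => /(_ _ 0); rewrite subr_gt0 => /(_ hk).
      apply: filterS => nu; rewrite subr_gt0 => nuk n kn; apply: le_lt_trans nuk.
      apply: le; [exact: trace_clopen|exact: trace_clopen|].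
      by move=> y; exact: trace_mono.
    exists k; apply: filterS (near_trace cD k x) => y yx n kn mu Kmu.
    apply: le_lt_trans (hk mu Kmu).
    apply: le; [exact: trace_clopen|exact: trace_clopen|].
    by move=> z /= /(trace_mono kn); rewrite /cylinder /= => ->.
  have [bs [cbs bsP bsE]] := cylinder_partition cD n cA.
  exists bs; split=> // b bbs [mu Kmu] /=.
  have [->|[x bx]] := bsP _ bbs.
    by rewrite /mass measure0 pos.
  apply: le_lt_trans (hn x I mu Kmu); apply: le => //; first exact: cbs.
  exact: trace_clopen.
Qed.

(** Clopen sets are closed under intersection and generate the Borel sets, so two finite measures
    agreeing on them coincide. *)
Lemma clopen_invariant (phi : homeo X cantor_space) mu (g : homeo X X) :
  (forall A, clopen A -> mu (g @^-1` A) = mu A) ->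
  forall A : set (borel X), measurable A ->
    pushforward mu (g : borel X -> borel X) A = mu A.
Proof.
move=> inv.
have cX := homeo_cantor_compact phi.
have zX := homeo_cantor_zero_dimensional phi.
have [E [cE surjE]] :=
  clopen_enumeration cX (coordinate_clopen phi) (@coordinate_sep _ phi).
have genE : @measurable _ (borel X) = <<s @clopen X >>.
  rewrite eqEsubset; split; last first.
    by apply: smallest_sub; [exact: smallest_sigma_algebra|exact: clopen_borel].
  apply: smallest_sub; first exact: smallest_sigma_algebra.
  move=> U oU.
  (* Countability of the clopen sets is what writes an open set as a countable union of them. *)
  have -> : U = \bigcup_n (if `[< E n `<=` U >] then E n else set0).
    rewrite predeqE => x; split=> [Ux|[n _]]; last by case: asboolP => // h /h.
    have [A [Ax cA] AU] := zero_dimensional_cvg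
      (zero_dimensional_hausdorff zX) zX cX (open_nbhs_nbhs (conj oU Ux)).
    have [n En] := surjE A cA; exists n => //.
    by rewrite asboolT En.
  apply: sigma_algebra_bigcup => n; case: asboolP => _.
    by apply: sub_sigma_algebra; exact: cE.
  exact: sigma_algebra0.
have mg : measurable_fun [set: borel X] (g : borel X -> borel X).
  apply: (@measurability _ _ (borel X) (borel X) _ _ (@open X)) => //.
  move=> _ [U oU <-]; rewrite setTI; apply: open_borel.
  by apply: open_comp oU => x _; exact: homeo_fun_continuous.
pose gm : {mfun borel X >-> borel X} :=
  HB.pack (g : borel X -> borel X) (isMeasurableFun.Build _ _ _ _ _ mg).
apply: (@measure_unique _ R (borel X) (@clopen X) (fun=> setT) genE _ _ _
  (distribution mu gm) mu) => //.
- by move=> U V; exact: clopenI.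
- by move=> _; exact: clopenT.
- by rewrite bigcup_const.
- move=> _.
  exact: (le_lt_trans (probability_le1 (distribution mu gm) measurableT) (ltry _)).
Qed.

End Measures.

Theorem proposition3p6 (R : realType) (X : ptopologicalType)
    (hX : is_cantor_space X) (K : set (borel_probability R X))
    (hK : dynamical_simplex K) :
  exists2 g : homeo X X, invariance_group K g & saturated K g.
Proof.
have [phi] := hX.
have zX := homeo_cantor_zero_dimensional phi.
have cX := homeo_cantor_compact phi.
have [E [cE surjE]] :=
  clopen_enumeration cX (coordinate_clopen phi) (@coordinate_sep _ phi).
have [g [gm gsat]] := saturated_homeo_exists (mass_family phi hK) cX
  (zero_dimensional_hausdorff zX) zX cE surjE.
exists g.
  move=> mu Kmu; apply: (clopen_invariant phi) => A cA.
  rewrite !massE//; last first.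
    by apply: preimage_clopen => //; exact: homeo_fun_continuous.
  by congr EFin; exact: (gm A cA (exist _ mu Kmu)).
move=> U V cU cV UV; apply: gsat => // -[mu Kmu] /=.
by rewrite /mass UV.
Qed.
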